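(* Let $a=(a_n)_{n\in\mathbb N}\in(0,1)^{\mathbb N}$. Assume that the set $\{n\in\mathbb N: a_n>\frac13\}$ is infinite. Let $k_0\in\mathbb N\cup\{0\}$ be such that $a_{k_0+1}<\frac13$. Let $(k_n)_{n\ge1}$ be the increasing sequence consisting of all indices $j$ greater than $k_0$ for which $a_{j}>\frac13$. Let $k\ge k_0$, $t\in\{0,1,2\}^k$ and let $m\in\mathbb N$ be such that $k_{m-1}\le k<k_m$. Let $d_0=1$ and $d_n=\prod_{i=1}^n\frac{1-a_i}{2}$. For $n\in\mathbb N$ denote $$\delta_n:=\min\{3d_i-d_{i-1}: i\in\{k_{n-1}+1,\dots,k_n-1\}\},\qquad \Delta_n:=\max\{3d_i-d_{i-1}: i\in\{k_{n-1}+1,\dots,k_n-1\}\},$$ where $\max\emptyset=-\infty$ and $\min\emptyset=\infty$, and put $$m_n:=\min\{\delta_n-(d_{k_n-1}-d_{k_n}),\ 4d_{k_n}-\Delta_n\}.$$ If for every $n\in\mathbb N$ $$m_n\ \ge\ 2\sum_{i=n+1}^{\infty}(d_{k_i-1}-d_{k_i}),$$ then the set $C(a)-C(a)$ is a Cantorval. Moreover, if $k=k_0=0$ and $t=\emptyset$, then $C(a)-C(a)=J_t\setminus\bigcup\mathcal G_t$ and $$|C(a)-C(a)|=2-2\sum_{n=1}^{\infty}3^{n-1}(d_{k_n-1}-3d_{k_n}).$$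
   Context: $\mathbb N=\{1,2,\dots\}$. $A-B=\{x-y:x\in A,\ y\in B\}$, and $|A|$ is the Lebesgue measure of $A$. For an interval $I$, $l(I),r(I),c(I)$ are its left endpoint, right endpoint and centre. Cantorval: a gap of $E\subset\mathbb R$ is a bounded connected component of $\mathbb R\setminus E$; a component of $E$ is proper if it is not a singleton. A perfect set $E\subset\mathbb R$ is a Cantorval (M-Cantorval) if it has infinitely many gaps and both endpoints of every gap are accumulated by gaps and by proper components of $E$. Central Cantor set $C(a)$, $a\in(0,1)^{\mathbb N}$: put $I_\emptyset=[0,1]$, $d_0=1$. Given $I_t$ of length $d_n$ for $t\in\{0,1\}^n$, remove from it the concentric open interval of length $a_{n+1}d_n$; let $I_{t\hat{}0}$, $I_{t\hat{}1}$ be the left and right components of what remains, of common length $d_{n+1}$. So $d_n=\prod_{i=1}^n\frac{1-a_i}{2}$. Let $C(a)=\bigcap_{n\in\mathbb N}\bigcup_{t\in\{0,1\}^n}I_t$. Sequences: $t\hat{}s$ is concatenation, $i^{(n)}$ is the sequence $(i,\dots,i)$ with $n$ terms, and $\{0,1,2\}^0=\{\emptyset\}$, where $\emptyset$ is the empty sequence. Intervals $J_s$: $J_\emptyset=[-1,1]$; for $s\in\{0,1,2\}^n$, $J_s:=I_t-I_p$ for any $t,p\in\{0,1\}^n$ with $s_i=t_i-p_i+1$ for all $i$ (this is independent of the choice). Equivalently, $J_{s\hat{}0}=[l(J_s),l(J_s)+2d_{n+1}]$, $J_{s\hat{}1}=[c(J_s)-d_{n+1},c(J_s)+d_{n+1}]$,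 $J_{s\hat{}2}=[r(J_s)-2d_{n+1},r(J_s)]$. Gaps: if $s\in\{0,1,2\}^n$ and $a_{n+1}>\frac13$, then $J_s\setminus(J_{s\hat{}0}\cup J_{s\hat{}1}\cup J_{s\hat{}2})$ is a union of two open intervals, $G^0_s=(r(J_{s\hat{}0}),l(J_{s\hat{}1}))$ and $G^1_s=(r(J_{s\hat{}1}),l(J_{s\hat{}2}))$. With $(k_n)$ as in the claim, for $t\in\{0,1,2\}^k$ and $k_n>k$ set $\bar G^0_t(n):=G^0_{t\hat{}0^{(k_n-k-1)}}$ and $\bar G^1_t(n):=G^1_{t\hat{}2^{(k_n-k-1)}}$. Families of gaps: for $m\in\mathbb N$, $s\in\{0,1,2\}^{k_m-1}$ and $j\in\{0,1\}$, define inductively $\mathcal G^j_s(m):=\{G^j_s\}$ and, for $n\ge m$, $$\mathcal G^j_s(n+1):=\{\bar G^j_s(n+1)\}\cup\bigcup_{m\le l\le n}\ \bigcup_{i\in\{0,1\}}\ \bigcup_{t:\,G^i_t\in\mathcal G^j_s(l)}\{\bar G^1_{t\hat{}i}(n+1),\ \bar G^0_{t\hat{}(i+1)}(n+1)\},$$ where $t$ ranges over $\{0,1,2\}^{k_l-1}$. Put $\mathcal G^j_s:=\bigcup_{n\ge m}\mathcal G^j_s(n)$. For $k\ge k_0$, $t\in\{0,1,2\}^k$ and $m\in\mathbb N$ with $k_{m-1}\le k<k_m$, set $$\mathcal G_t:=\mathcal G^0_{t\hat{}0^{(k_m-k-1)}}\cup\mathcal G^1_{t\hat{}2^{(k_m-k-1)}}.$$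 *)

(* Defs.v *)
From HB Require Import structures.
From mathcomp Require Import all_boot all_order all_algebra.
From mathcomp Require Import all_classical all_reals all_analysis.
From mathcomp Require Import ring lra.
Set Implicit Arguments.
Unset Strict Implicit.
Unset Printing Implicit Defensive.
Import Order.TTheory GRing.Theory Num.Theory.
Import numFieldNormedType.Exports.
Local Open Scope classical_set_scope.
Local Open Scope ring_scope.

Section Cantorval.
Context {R : realType}.
Implicit Types (E U : set R) (x : R) (F : set (set R)).

Definition diff_set (A B : set R) : set R := [set x - y | x in A & y in B].

Definition components E : set (set R) := connected_component E @` E.

Definition gaps E : set (set R) :=
  [set U | components (~` E) U /\ bounded_set U].

Definition proper_components E : set (set R) :=
  [set U | components E U /\ ~ (exists x, U = [set x])].

(* Only used for families F of pairwise disjoint sets; requiring infinitely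
   many members of F near x excludes that the only witness is the member of F
   having x as an endpoint. *)
Definition accum_at x F :=
  forall V : set R, nbhs x V -> infinite_set [set U | F U /\ U `<=` V].

Definition cantorval E :=
  [/\ perfect_set E, infinite_set (gaps E) &
    forall U, gaps E U -> forall x, x = inf U \/ x = sup U ->
      accum_at x (gaps E) /\ accum_at x (proper_components E)].

End Cantorval.

Section CentralCantorSet.
Context {R : realType}.
(* Sequences are indexed from 1: the value a 0 is never used. *)
Variable a : nat -> R.

Definition dlen (n : nat) : R := \prod_(1 <= i < n.+1) ((1 - a i) / 2).

(* Closed intervals are represented by their pairs of endpoints. *)
Definition itv_set (I : R * R) : set R := [set` `[I.1, I.2]].

Definition center (I : R * R) : R := (I.1 + I.2) / 2.

(* [descend child n I s] follows the word s from left to right, starting from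
   the interval I of level n, so that the interval of rcons s x is the child
   number x of the interval of s. *)
Fixpoint descend (T : Type) (child : nat -> R * R -> T -> R * R)
    (n : nat) (I : R * R) (s : seq T) : R * R :=
  if s is x :: s' then descend child n.+1 (child n I x) s' else I.

(* true and false are the digits 1 and 0 *)
Definition Ichild (n : nat) (I : R * R) (b : bool) : R * R :=
  if b then (center I + a n.+1 * dlen n / 2, I.2)
  else (I.1, center I - a n.+1 * dlen n / 2).

Definition Iends (t : seq bool) : R * R := descend Ichild 0 (0, 1) t.

Definition central_cantor : set R :=
  \bigcap_(n in [set n | (0 < n)%N]) \bigcup_(t : n.-tuple bool)
    itv_set (Iends t).

Definition Jchild (n : nat) (J : R * R) (i : 'I_3) : R * R :=
  if i == 0%N :> nat then (J.1, J.1 + 2 * dlen n.+1)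
  else if i == 1%N :> nat then (center J - dlen n.+1, center J + dlen n.+1)
  else (J.2 - 2 * dlen n.+1, J.2).

Definition Jends (s : seq 'I_3) : R * R := descend Jchild 0 (-1, 1) s.

Definition Jset (s : seq 'I_3) : set R := itv_set (Jends s).

(* The digits j and j + 1 of {0,1,2}, for j in {0,1} *)
Definition dig (j : 'I_2) : 'I_3 := widen_ord (leqnSn 2) j.
Definition digS (j : 'I_2) : 'I_3 := lift ord0 j.

(* G^j_s; it is a gap between children of J_s only when
   a (size s).+1 > 1/3. *)
Definition gap (j : 'I_2) (s : seq 'I_3) : set R :=
  [set` `](Jends (rcons s (dig j))).2, (Jends (rcons s (digS j))).1[].

(* The digit 2j used to pad words: 0 for G^0 and 2 for G^1 *)
Definition pad (j : 'I_2) : 'I_3 := if j == ord0 then ord0 else ord_max.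

Variable kk : nat -> nat.

Definition padto (j : 'I_2) (t : seq 'I_3) (n : nat) : seq 'I_3 :=
  t ++ nseq (kk n - size t - 1) (pad j).

Definition gapbar (j : 'I_2) (t : seq 'I_3) (n : nat) : set R :=
  gap j (padto j t n).

(* [gap_family j s m n] is the n-th family generated by G^j_s, where
   size s = kk m - 1; it is empty for n < m. *)
Inductive gap_family (j : 'I_2) (s : seq 'I_3) (m : nat) :
    nat -> set R -> Prop :=
| gap_family_start : gap_family j s m m (gap j s)
| gap_family_main (n : nat) : (m <= n)%N ->
    gap_family j s m n.+1 (gapbar j s n.+1)
| gap_family_left (n l : nat) (i : 'I_2) (t : seq 'I_3) :
    (m <= l <= n)%N -> size t = (kk l - 1)%N ->
    gap_family j s m l (gap i t) ->
    gap_family j s m n.+1 (gapbar ord_max (rcons t (dig i)) n.+1)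
| gap_family_right (n l : nat) (i : 'I_2) (t : seq 'I_3) :
    (m <= l <= n)%N -> size t = (kk l - 1)%N ->
    gap_family j s m l (gap i t) ->
    gap_family j s m n.+1 (gapbar ord0 (rcons t (digS i)) n.+1).

Definition gap_family_all (j : 'I_2) (s : seq 'I_3) (m : nat) : set (set R) :=
  \bigcup_(n in [set n | (m <= n)%N]) gap_family j s m n.

(* The family of gaps attached to t, where kk m.-1 <= size t < kk m *)
Definition gaps_of (t : seq 'I_3) (m : nat) : set (set R) :=
  gap_family_all ord0 (padto ord0 t m) m `|`
  gap_family_all ord_max (padto ord_max t m) m.

(* The bounds below are extended reals, as the range of i may be empty. *)
Definition delta (n : nat) : \bar R :=
  \big[Order.min/+oo%E]_((kk n.-1).+1 <= i < kk n)
    (3 * dlen i - dlen i.-1)%:E.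

Definition Delta (n : nat) : \bar R :=
  \big[Order.max/-oo%E]_((kk n.-1).+1 <= i < kk n)
    (3 * dlen i - dlen i.-1)%:E.

Definition mbound (n : nat) : \bar R :=
  Order.min (delta n - (dlen (kk n).-1 - dlen (kk n))%:E)%E
            ((4 * dlen (kk n))%:E - Delta n)%E.

End CentralCantorSet.

(* The recursive description of J_s agrees with J_s = I_t - I_p for all words
   t, p such that s_i = t_i - p_i + 1. *)
Definition diff_digit (x y : bool) : 'I_3 := inord (x + ~~ y).

Section JDifference.
Context {R : realType}.
Variable a : nat -> R.
Hypothesis a01 : forall n, (0 < n)%N -> 0 < a n < 1.

Lemma dlenS n : dlen a n.+1 = dlen a n * ((1 - a n.+1) / 2).
Proof. by rewrite /dlen big_nat_recr. Qed.

Lemma dlen_gt0 n : 0 < dlen a n.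
Proof.
elim: n => [|n IH]; first by rewrite /dlen big_nil.
rewrite dlenS mulr_gt0 //; have /andP[_ h] := a01 (ltn0Sn n); lra.
Qed.

Lemma descend_diff n (I I' J : R * R) (t p : seq bool) : size t = size p ->
  I.2 = I.1 + dlen a n -> I'.2 = I'.1 + dlen a n ->
  J.1 = I.1 - I'.2 -> J.2 = I.2 - I'.1 ->
  let It := descend (Ichild a) n I t in
  let Ip := descend (Ichild a) n I' p in
  let Js := descend (Jchild a) n J
    [seq diff_digit b.1 b.2 | b <- zip t p] in
  [/\ It.2 = It.1 + dlen a (n + size t),
      Ip.2 = Ip.1 + dlen a (n + size t),
      Js.1 = It.1 - Ip.2 & Js.2 = It.2 - Ip.1].
Proof.
elim: t p n I I' J => [|x t IH] [|y p] //= n I I' J; first by rewrite addn0.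
move=> [eqs] hI hI' hJ1 hJ2; rewrite addnS -addSn.
apply: IH => //; case: x; case: y;
  rewrite /Ichild /Jchild /center /diff_digit /= ?inordK //= ?hJ1 ?hJ2 ?hI ?hI' dlenS;
  by [|field].
Qed.

Lemma Jset_diff (t p : seq bool) : size t = size p ->
  Jset a [seq diff_digit b.1 b.2 | b <- zip t p] =
  diff_set (itv_set (Iends a t)) (itv_set (Iends a p)).
Proof.
move=> eqs; have := @descend_diff 0 (0, 1) (0, 1) (-1, 1) t p eqs.
have d0 : dlen a 0 = 1 by rewrite /dlen big_nil.
rewrite /= d0 !add0r subr0 => /(_ erefl erefl erefl erefl).
rewrite /Jset /Jends /Iends add0n.
have := dlen_gt0 (size t); move: (dlen a (size t)) => e e0.
move: (descend _ _ _ t) => [u v]; move: (descend _ _ _ p) => [w z].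
move: (descend _ _ _ _) => [x y] /= [-> -> -> ->].
rewrite /diff_set /itv_set /=; apply/seteqP; split => q /=.
  rewrite in_itv /= => /andP[q1 q2].
  case: (leP q (u - w)) => h.
    exists u; first by rewrite /= in_itv /=; apply/andP; split; lra.
    exists (u - q); last by lra.
    by rewrite /= in_itv /=; apply/andP; split; lra.
  exists (q + w); first by rewrite /= in_itv /=; apply/andP; split; lra.
  exists w; last by lra.
  by rewrite /= in_itv /=; apply/andP; split; lra.
move=> [r]; rewrite /= in_itv /= => /andP[r1 r2].
move=> [s]; rewrite /= in_itv /= => /andP[s1 s2] <-.
by rewrite in_itv /=; apply/andP; split; lra.
Qed.

End JDifference.

(* Main.v *)
Require Import Defs.
From HB Require Import structures.
From mathcomp Require Import all_boot all_order all_algebra.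
From mathcomp Require Import all_classical all_reals all_analysis.
From mathcomp Require Import ring lra zify.
Import Order.TTheory GRing.Theory Num.Theory.
Import numFieldNormedType.Exports.
Local Open Scope classical_set_scope.
Local Open Scope ring_scope.

(** Let d_k be the common length of the intervals of level k.  The part of C(a)
    inside such an interval is a translate of a set C_k contained in [0, d_k],
    and C_k is the union of C_(k+1) and its translate by d_k - d_(k+1).  Hence
    the sets D_k = C_k - C_k satisfy
      D_k = D_(k+1) + {- r, 0, r}  with  r = d_k - d_(k+1)  ([diff_tailS]),
    and D_0 = C(a) - C(a).

    Explicit form of D_k.  For k_(m-1) <= k < k_m the set D_k is [- d_k, d_k]
    minus an open set of gaps clustering at its left end, [edge_gaps m] in
    coordinates starting at that end, and minus the mirror image at its right
    end ([diff_tail_trimmed]).  Sets of this form obey the recursion above, and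
    since d_k tends to 0 the recursion has only one solution by nonempty closed
    subsets of the intervals [- d_k, d_k] ([ternary_approx]).  To see that they
    obey it, there are two cases.  If k + 1 = k_m, the three children are disjoint, and the gaps at their six
    ends, with the two gaps between them, are exactly the gaps of the parent
    ([trim_separate]).  Otherwise neighbouring children overlap in length
    3 d_(k+1) - d_k, and every gap near an inner end of a child has to be
    covered by the neighbour ([trim_overlap]).  That could fail only if two
    points of [edge_gaps m] added up to the length of the overlap.  But
    [edge_gaps m] lies within sum_(i > m) r_(k_i) of 0 or of the first gap
    (2 d_(k_m), r_(k_m)), where r_i = d_(i-1) - d_i, and the hypothesis on m_n
    guarantees that overlaps avoid all such sums ([edge_gaps_add]).

    Cantorval.  The total reach of the gaps at an end of D_(k_m) is smaller
    than d_(k_m) ([jumps_lt]), so every D_k contains an interval.  The rest is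
    the argument of Guthrie and Nymann.  A right endpoint b of a gap of D_0 is
    the minimum of every sufficiently short piece of D_0 containing it, so near
    b the set D_0 is a translate of D_n near its minimum ([gap_end_aligned]).
    Whenever a_(n+1) > 1/3, the leftmost child in D_n is followed by a gap, so
    this child shows both a gap and a proper component close to b
    ([ragged_aligned]).  Left endpoints follow from D_0 = - D_0.

    Measure.  The gaps of [edge_gaps 1] of generation j (those of the level
    k_(j+1)) are 3^j intervals of length d_(k_(j+1) - 1) - 3 d_(k_(j+1)), all
    gaps are pairwise disjoint, and there is one such system at each end of
    [-1, 1] ([trim_measure]).  The generation of gaps by gaps in the definition
    of the families and the self-similar generation used here give the same
    intervals ([gap_family_cell], [cell_gap_family]). *)

Set Implicit Arguments.
Unset Strict Implicit.
Unset Printing Implicit Defensive.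

(** * Interval lengths and the tails of the Cantor set *)

Section Lengths.
Context {R : realType} (a : nat -> R).
Context (a01 : forall n, (0 < n)%N -> 0 < a n < 1).
Local Notation d := (dlen a).

Lemma dlen0 : d 0 = 1.
Proof. by rewrite /dlen big_nil. Qed.

Lemma dlenS_lt n : 2 * d n.+1 < d n.
Proof.
rewrite dlenS; have /andP[h1 h2] := a01 (ltn0Sn n).
have d0 := dlen_gt0 a01 n; have : 0 < d n * a n.+1 by rewrite mulr_gt0.
lra.
Qed.

Lemma dlen_le k n : (k <= n)%N -> d n <= d k.
Proof.
elim: n => [|n IH]; first by rewrite leqn0 => /eqP ->.
rewrite leq_eqVlt => /orP[/eqP -> //|]; rewrite ltnS => /IH.
have := dlenS_lt n; have := dlen_gt0 a01 n.+1; lra.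
Qed.

Lemma dlen_inv n : d n <= n.+1%:R^-1.
Proof.
elim: n => [|n IH]; first by rewrite dlen0 invr1.
have h := dlenS_lt n; have h0 := dlen_gt0 a01 n.+1.
rewrite -[leRHS]mul1r ler_pdivlMr ?ltr0n //.
move: IH; rewrite -[leRHS]mul1r ler_pdivlMr ?ltr0n // => IH.
apply: le_trans IH.
rewrite (_ : d n * n.+1%:R = d n / 2 * (2 * n.+1%:R)); last by field.
apply: ler_pM; [lra|by rewrite ler0n|lra|].
by rewrite -natrM ler_nat; lia.
Qed.

Lemma dlen_small (e : R) : 0 < e -> exists N, forall n, (N <= n)%N -> d n < e.
Proof.
move=> e0; have [N hN] := ltr_add_invr e0; exists N => n Nn.
apply: le_lt_trans (dlen_le Nn) _; apply: le_lt_trans (dlen_inv N) _.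
by move: hN; rewrite add0r.
Qed.

(** The condition a_(n+1) > 1/3 means that three children leave gaps. *)
Lemma gap_cond n : (1 / 3 < a n.+1) = (3 * d n.+1 < d n).
Proof.
rewrite dlenS; have d0 := dlen_gt0 a01 n.
have -> : 3 * (d n * ((1 - a n.+1) / 2)) = d n + (1 - 3 * a n.+1) / 2 * d n.
  by field.
rewrite gtrDl pmulr_llt0 //; apply/idP/idP; lra.
Qed.

End Lengths.

Section Tails.
Context {R : realType} (a : nat -> R).
Context (a01 : forall n, (0 < n)%N -> 0 < a n < 1).
Local Notation d := (dlen a).

(** The approximation, N levels deeper, of the part of C(a) inside one interval of
    level k, that interval being translated to [0, dlen a k]. *)
Fixpoint tail_approx (N k : nat) : set R :=
  if N is N'.+1 then
    [set x | tail_approx N' k.+1 x \/ tail_approx N' k.+1 (x - (d k - d k.+1))]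
  else [set x | 0 <= x <= d k].

Definition cantor_tail (k : nat) : set R := \bigcap_N tail_approx N k.

Lemma tail_approxS N k : tail_approx N.+1 k `<=` tail_approx N k.
Proof.
elim: N k => [|N IH] k x /=; last by case=> h; [left|right]; apply: IH.
have := dlenS_lt a01 k; have := dlen_gt0 a01 k.+1.
by move=> h1 h2 [|] /andP[h3 h4]; apply/andP; split; lra.
Qed.

Lemma tail_approx_le N M k : (N <= M)%N -> tail_approx M k `<=` tail_approx N k.
Proof.
move=> /subnK <-; elim: (M - N)%N => [//|n IH]; rewrite addSn.
exact: subset_trans (@tail_approxS _ _) IH.
Qed.

Lemma closed_shift (A : set R) c : closed A -> closed [set x | A (x - c)].
Proof.
move=> cA; apply: (@preimage_closed _ _ (fun x => x - c) A) cA => x _.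
by apply: cvgB; [exact: cvg_id|exact: cvg_cst].
Qed.

Lemma closed_tail_approx N k : closed (tail_approx N k).
Proof.
elim: N k => [|N IH] k /=.
  rewrite (_ : [set _ | _] = [set x | 0 <= x] `&` [set x | x <= d k]).
    by apply: closedI; [exact: closed_ge|exact: closed_le].
  by apply/seteqP; split => x /= => [/andP[]|[-> ->]].
by apply: closedU; [exact: IH|apply: closed_shift].
Qed.

Lemma closed_cantor_tail k : closed (cantor_tail k).
Proof. by apply: closed_bigI => N _; exact: closed_tail_approx. Qed.

Lemma cantor_tail_itv k x : cantor_tail k x -> 0 <= x <= d k.
Proof. by move=> /(_ 0%N I). Qed.

(** A point of the tail lies in one of the two children at every depth, hence in
    the same child at infinitely many depths, hence at all of them as the
    approximations decrease. *)
Lemma cantor_tailS k x :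
  cantor_tail k x <-> cantor_tail k.+1 x \/ cantor_tail k.+1 (x - (d k - d k.+1)).
Proof.
split=> [h|].
  apply: contrapT => /not_orP[/existsNP[N /not_implyP[_ hN]]].
  move=> /existsNP[M /not_implyP[_ hM]].
  have [/= g|/= g] := h (maxn N M).+1 I.
    by apply: hN; apply: tail_approx_le g; rewrite leq_maxl.
  by apply: hM; apply: tail_approx_le g; rewrite leq_maxr.
by case=> h N _; apply: tail_approxS => /=; [left|right]; exact: h.
Qed.

Lemma cantor_tail_end k : cantor_tail k 0 /\ cantor_tail k (d k).
Proof.
split=> N _; elim: N k => [|N IH] k /=.
- by rewrite lexx ltW // dlen_gt0.
- by left.
- by rewrite lexx ltW // dlen_gt0.
- by right; rewrite opprB addrCA subrr addr0.
Qed.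

Lemma descend_tail_approx N k l x :
  tail_approx N k (x - l) <->
  exists2 t : seq bool, size t = N &
    itv_set (descend (Ichild a) k (l, l + d k) t) x.
Proof.
have e0 i y t : descend (Ichild a) i (y, y + d i) (false :: t) =
    descend (Ichild a) i.+1 (y, y + d i.+1) t.
  rewrite /= {2}/Ichild /Defs.center /= dlenS.
  by congr (descend _ _ (_, _) _); field.
have e1 i y t : descend (Ichild a) i (y, y + d i) (true :: t) =
    descend (Ichild a) i.+1
      (y + (d i - d i.+1), y + (d i - d i.+1) + d i.+1) t.
  rewrite /= {2}/Ichild /Defs.center /= dlenS.
  by congr (descend _ _ (_, _) _); field.
elim: N k l => [|N IH] k l /=.
  split=> [/andP[h1 h2]|[[|//] _]].
    by exists [::] => //=; rewrite /itv_set /= in_itv /=; apply/andP; split; lra.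
  by rewrite /itv_set /= in_itv /= => /andP[h1 h2]; apply/andP; split; lra.
have -> : x - l - (d k - d k.+1) = x - (l + (d k - d k.+1)) by ring.
rewrite !IH; split=> [[] [t st ht]|[[//|b t] [st]]].
- by exists (false :: t); rewrite ?e0 // -st.
- by exists (true :: t); rewrite ?e1 // -st.
- by case: b; rewrite ?e0 ?e1 => ht; [right|left]; exists t.
Qed.

Lemma central_cantorE : central_cantor a = cantor_tail 0.
Proof.
have e N x : tail_approx N 0 x <-> exists t : N.-tuple bool, itv_set (Iends a t) x.
  have := descend_tail_approx N 0 0 x; rewrite subr0 add0r (dlen0 a) => ->.
  split=> [[t st ht]|[t ht]]; last by exists t; rewrite ?size_tuple.
  by exists (tcast st (in_tuple t)); rewrite val_tcast.
apply/seteqP; split=> x h.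
  move=> N _; apply: tail_approxS; apply/e.
  by have [t _ ht] := h N.+1 isT; exists t.
by move=> N N0; have /e[t ht] := h N I; exists t.
Qed.

Definition diff_tail (k : nat) : set R := diff_set (cantor_tail k) (cantor_tail k).

(** The three shifts are the differences of the two shifts 0 and
    dlen a k - dlen a k.+1 of the children of the tail. *)
Lemma diff_tailS k x : diff_tail k x <->
  [\/ diff_tail k.+1 (x + (d k - d k.+1)), diff_tail k.+1 x |
      diff_tail k.+1 (x - (d k - d k.+1))].
Proof.
split.
  case=> y /cantor_tailS[] hy [z] /cantor_tailS[] hz <-.
  - by constructor 2; exists y => //; exists z.
  - by constructor 1; exists y => //; exists (z - (d k - d k.+1)) => //; ring.
  - by constructor 3; exists (y - (d k - d k.+1)) => //; exists z => //; ring.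
  - constructor 2; exists (y - (d k - d k.+1)) => //.
    by exists (z - (d k - d k.+1)) => //; ring.
have shift y : cantor_tail k.+1 y -> cantor_tail k (y + (d k - d k.+1)).
  by move=> h; apply/cantor_tailS; right; rewrite addrK.
have keep y : cantor_tail k.+1 y -> cantor_tail k y.
  by move=> h; apply/cantor_tailS; left.
case=> -[y hy [z hz e]].
- exists y; [exact: keep|exists (z + (d k - d k.+1)); [exact: shift|]].
  by rewrite opprD addrA e addrK.
- by exists y; [exact: keep|exists z; [exact: keep|]].
- exists (y + (d k - d k.+1)); [exact: shift|exists z; [exact: keep|]].
  by rewrite addrAC e subrK.
Qed.

Lemma diff_tail_itv k x : diff_tail k x -> - d k <= x <= d k.
Proof.
move=> [y /cantor_tail_itv/andP[h1 h2] [z /cantor_tail_itv/andP[h3 h4] <-]].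
by apply/andP; split; lra.
Qed.

Lemma diff_tail_end k : diff_tail k (- d k) /\ diff_tail k (d k).
Proof.
have [h0 h1] := cantor_tail_end k; split.
  by exists 0 => //; exists (d k) => //; rewrite sub0r.
by exists (d k) => //; exists 0 => //; rewrite subr0.
Qed.

Lemma diff_tailN k x : diff_tail k x -> diff_tail k (- x).
Proof. by move=> [y hy [z hz <-]]; exists z => //; exists y => //; rewrite opprB. Qed.

Lemma closed_diff_tail k : closed (diff_tail k).
Proof.
have cC : compact (cantor_tail k).
  apply: (@subclosed_compact _ _ `[0, d k]); last 1 first.
  - by move=> x /cantor_tail_itv; rewrite /= in_itv.
  - exact: closed_cantor_tail.
  - exact: segment_compact.
apply: compact_closed; first exact: Rhausdorff.
rewrite (_ : diff_tail k =
    (fun p : R * R => p.1 - p.2) @` (cantor_tail k `*` cantor_tail k)).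
  apply: continuous_compact; last exact: compact_setX.
  apply: continuous_subspaceT => p.
  by apply: cvgB; [exact: cvg_fst|exact: cvg_snd].
apply/seteqP; split=> x.
  by move=> [y hy [z hz <-]]; exists (y, z).
by move=> [[y z] [hy hz] <-]; exists y => //; exists z.
Qed.

End Tails.

(** * Gaps and proper components of closed subsets of the line *)

Section Line.
Context {R : realType}.
Implicit Types (E U : set R) (b : R).

(** An order-theoretic form of a bounded gap, free of connected components. *)
Definition gap_between E (u v : R) :=
  [/\ u < v, E u, E v & forall x, u < x < v -> ~ E x].

(** A witness that E has a proper component between p and q: a nondegenerate
    interval of E confined by two points outside E. *)
Definition island E (p q : R) :=
  [/\ ~ E p, ~ E q &
    exists u v, [/\ p < u, u < v, v < q & forall x, u <= x <= v -> E x]].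

(** Accumulation of gaps and of proper components at b, stated by inequalities
    only, so that it is visibly preserved by reflection. *)
Definition ragged E b := forall e, 0 < e ->
  (exists u v, [/\ b - e < u, v < b + e & gap_between E u v]) /\
  (exists p q, [/\ b - e < p, q < b + e & island E p q]).

Lemma nbhs_radius b (V : set R) : nbhs b V ->
  exists2 e : R, 0 < e & forall x : R, b - e < x < b + e -> V x.
Proof.
move=> /nbhs_ballP[e /= e0 h]; exists e => // x /andP[h1 h2].
by apply: h; rewrite /ball /= ltr_norml; apply/andP; split; lra.
Qed.

(** One member of F near b suffices at each scale.  If only finitely many members
    of F were contained in V, remove from V a point other than b of each of them:
    a member of F inside the remaining neighbourhood of b would be one of them,
    yet miss its removed point. *)
Lemma accum_at_small b (F : set (set R)) :
  (forall e, 0 < e -> exists U, [/\ F U, forall x, U x -> b - e < x < b + e &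
    exists2 x, U x & x <> b]) -> accum_at b F.
Proof.
move=> h V Vb finG.
(* b + 1 is a default value different from b *)
pose f (U : set R) : R := xget (b + 1) [set x | U x /\ x <> b].
set G := [set U | F U /\ U `<=` V] in finG.
have fb U : f U <> b.
  by rewrite /f; case: xgetP => [x _ []//|_]; lra.
have cl : closed (f @` G).
  move/accessible_finite_set_closed: (hausdorff_accessible (@Rhausdorff R)).
  by apply; exact: finite_image.
have Wb : nbhs b (V `&` ~` (f @` G)).
  apply: filterI => //; apply: open_nbhs_nbhs; split; first exact: closed_openC.
  by move=> [U _ /fb].
have [e e0 he] := nbhs_radius Wb.
have [U [FU Ue [x Ux xb]]] := h e e0.
have GU : G U by split => // y /Ue /he[].
have /Ue/he[_] : U (f U).
  by rewrite /f; case: xgetP => [y _ []//|/(_ x) hn]; case: hn.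
by apply; exists U.
Qed.

Lemma gap_between_component E u v z : gap_between E u v -> u < z < v ->
  connected_component (~` E) z = [set` `]u, v[].
Proof.
move=> [uv Eu Ev nE] uzv; have nEz : (~` E) z by exact: nE.
apply/seteqP; split; last first.
  apply: connected_component_max; first by rewrite /= in_itv.
    by move=> x /=; rewrite in_itv => /nE.
  by apply/connected_intervalP; exact: interval_is_interval.
move=> x hx; have /connected_intervalP itvU := @component_connected _ (~` E) z.
have hz := connected_component_refl nEz; move/andP: uzv => [uz zv].
rewrite /= in_itv /=; apply/andP; split; rewrite ltNge; apply/negP => hxu.
  by have /connected_component_sub : connected_component (~` E) z u
    by apply: (itvU _ _ hx hz); apply/andP; split=> //; exact: ltW.
by have /connected_component_sub : connected_component (~` E) z v
  by apply: (itvU _ _ hz hx); apply/andP; split=> //; exact: ltW.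
Qed.

Lemma gap_between_gaps E u v : gap_between E u v -> gaps E [set` `]u, v[].
Proof.
move=> guv; have [uv _ _ nE] := guv.
have mid : u < (u + v) / 2 < v by apply/andP; split; lra.
split; first by exists ((u + v) / 2); [exact: nE|exact: gap_between_component].
exists (`|u| + `|v|); split; first by rewrite realE addr_ge0.
move=> M hM x /=; rewrite in_itv /= ler_norml => /andP[ux xv].
have := ler_norm u; have := ler_norm v; have := ler_norm (- u).
have := ler_norm (- v); have := normr_ge0 u; have := normr_ge0 v.
by rewrite !normrN => *; apply/andP; split; lra.
Qed.

Lemma closed_least E z : closed E -> ~ E z -> (exists2 y, E y & z < y) ->
  exists v, [/\ E v, z < v & forall x, z <= x < v -> ~ E x].
Proof.
move=> cE nEz [y Ey zy]; pose A := E `&` [set x | z <= x].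
have cA : closed A by apply: closedI => //; exact: closed_ge.
have lbA : lbound A z by move=> x [].
have A0 : A !=set0 by exists y; split => //=; exact: ltW.
have hA : has_lbound A by exists z.
have [Ei zi] : A (inf A).
  apply: cA => V /nbhs_radius[e e0 he].
  have [x Ax hx] := inf_adherent e0 (conj A0 hA).
  exists x; split => //; apply: he; rewrite hx andbT.
  by have := ge_inf hA Ax; lra.
exists (inf A); split => //.
  by rewrite lt_neqAle zi andbT; apply: contra_notN nEz => /eqP ->.
move=> x /andP[zx xi] Ex; have := ge_inf hA (conj Ex zx : A x); lra.
Qed.

Lemma closed_opp E : closed E -> closed [set x | E (- x)].
Proof.
move=> cE; apply: (@preimage_closed _ _ -%R E) cE => x _; exact: opp_continuous.
Qed.

Lemma closed_greatest E z : closed E -> ~ E z -> (exists2 y, E y & y < z) ->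
  exists v, [/\ E v, v < z & forall x, v < x <= z -> ~ E x].
Proof.
move=> cE nEz [y Ey zy].
have [||v [Ev zv nE]] := @closed_least [set x | E (- x)] (- z) (closed_opp cE).
- by rewrite /= opprK.
- by exists (- y); rewrite /= ?opprK //; lra.
exists (- v); split=> // [|x hx Ex]; first lra.
by apply: (nE (- x)); rewrite /= ?opprK //; lra.
Qed.

(** If E had no point on one side of z, the component of z in the complement
    would contain a half-line and be unbounded. *)
Lemma gapsP E U : closed E -> gaps E U ->
  exists u v, gap_between E u v /\ U = [set` `]u, v[].
Proof.
move=> cE [[z nEz <-]] [M [_ bM]].
have hb x : connected_component (~` E) z x -> `|x| <= `|M| + 1.
  move=> hx; apply: bM hx; have := ler_norm M; lra.
have ray (I : set R) : is_interval I -> I z -> I `<=` ~` E ->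
    forall x, I x -> `|x| <= `|M| + 1.
  move=> iI Iz nE x Ix; apply: hb.
  by apply: (connected_component_max Iz nE) Ix; apply/connected_intervalP.
have zM := hb _ (connected_component_refl nEz).
have [||v [Ev zv nEv]] := @closed_least E z cE.
- exact: nEz.
- apply: contrapT => /forall2NP nE.
  have : `|(`|M| + 2)| <= `|M| + 1.
    apply: (ray [set x | z <= x]) => /=; [|by []| |].
    + by move=> x y /= zx zy w /andP[xw _]; lra.
    + move=> x /=; rewrite le_eqVlt => /orP[/eqP <- //|zx].
      by case: (nE x).
    + by have := ler_norm z; lra.
  by have := ler_norm (`|M| + 2); lra.
have [||u [Eu uz nEu]] := @closed_greatest E z cE.
- exact: nEz.
- apply: contrapT => /forall2NP nE.
  have : `|- (`|M| + 2)| <= `|M| + 1.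
    apply: (ray [set x | x <= z]) => /=; [|by []| |].
    + by move=> x y /= zx zy w /andP[xw wy]; lra.
    + move=> x /=; rewrite le_eqVlt => /orP[/eqP -> //|zx].
      by case: (nE x).
    + by move: zM; rewrite ler_norml => /andP[]; lra.
  by rewrite normrN; have := ler_norm (`|M| + 2); lra.
have guv : gap_between E u v.
  split=> //; first lra; move=> x /andP[ux xv].
  by case: (leP x z) => xz; [apply: nEu|apply: nEv]; lra.
exists u, v; split => //.
by apply: gap_between_component => //; apply/andP.
Qed.

Lemma island_component E p q : island E p q -> exists U, [/\ proper_components E U,
  forall x, U x -> p < x < q & forall b, exists2 x, U x & x <> b].
Proof.
move=> [nEp nEq [u [v [pu uv vq hE]]]].
have Eu : E u by apply: hE; rewrite lexx ltW.
have sub : [set` `[u, v]] `<=` connected_component E u.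
  apply: connected_component_max.
  - by rewrite /= in_itv /= lexx ltW.
  - by move=> x /=; rewrite in_itv => /hE.
  - by apply/connected_intervalP; exact: interval_is_interval.
have Uu : connected_component E u u by apply: connected_component_refl.
have Uv : connected_component E u v by apply: sub; rewrite /= in_itv /= lexx ltW.
have two b : exists2 x, connected_component E u x & x <> b.
  case: (eqVneq u b) => [<-|/eqP ub]; last by exists u.
  by exists v => //; lra.
have /connected_intervalP itvU := @component_connected _ E u.
exists (connected_component E u); split => //.
  split; first by exists u.
  by move=> [x hx]; have [y] := two x; rewrite hx.
move=> x hx; apply/andP; split; rewrite ltNge; apply/negP => hxp.
  apply/nEp/(@connected_component_sub _ E u).
  by apply: (itvU _ _ hx Uu); apply/andP; split => //; exact: ltW.
apply/nEq/(@connected_component_sub _ E u).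
by apply: (itvU _ _ Uu hx); apply/andP; split => //; lra.
Qed.

Lemma ragged_accum E b : ragged E b ->
  accum_at b (gaps E) /\ accum_at b (proper_components E).
Proof.
move=> h; split; apply: accum_at_small => e e0; have [hg hi] := h e e0.
  have [u [v [bu bv g]]] := hg; have [uv Eu Ev nE] := g.
  exists [set` `]u, v[]; split; first exact: gap_between_gaps.
    by move=> x; rewrite /= in_itv /= => /andP[ux xv]; apply/andP; split; lra.
  case: (eqVneq ((u + v) / 2) b) => [<-|/eqP nb].
    exists ((3 * u + v) / 4); last by lra.
    by rewrite /= in_itv /=; apply/andP; split; lra.
  by exists ((u + v) / 2) => //; rewrite /= in_itv /=; apply/andP; split; lra.
have [p [q [bp qb /island_component[U [hU hpq two]]]]] := hi.
exists U; split => // x /hpq/andP[px xq]; apply/andP; split; lra.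
Qed.

Lemma cantorval_ragged E : closed E ->
  (forall x, E x -> forall e, 0 < e -> exists y, [/\ E y, y <> x & `|y - x| < e]) ->
  (forall u v, gap_between E u v -> ragged E u /\ ragged E v) ->
  (exists b, ragged E b) -> cantorval E.
Proof.
move=> cE perf end_ragged [b /ragged_accum[bg _]]; split.
- split=> //; apply/seteqP; split=> x.
    by move=> /subset_limit_point; exact: cE.
  move=> Ex V /nbhs_radius[e e0 he].
  have [y [Ey yx hy]] := perf x Ex e e0.
  exists y; split => //; first exact/eqP.
  by apply: he; move: hy; rewrite ltr_norml => /andP[h1 h2]; apply/andP; split; lra.
- apply: sub_infinite_set (bg setT filterT).
  by move=> U [].
- move=> U /(gapsP cE)[u [v [guv ->]]] x; have [uv _ _ _] := guv.
  have [ru rv] := end_ragged u v guv.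
  rewrite inf_itv ?bnd_simp // sup_itv ?bnd_simp //.
  by case=> ->; exact: ragged_accum.
Qed.

Lemma ragged_opp E b : (forall x, E x -> E (- x)) -> ragged E b -> ragged E (- b).
Proof.
move=> sE h e e0; have [[u [v [h1 h2 [uv Eu Ev nE]]]] hi] := h e e0.
have sE' x : E (- x) -> E x by move=> /sE; rewrite opprK.
split.
  exists (- v), (- u); split; [lra|lra|split; [lra|exact: sE|exact: sE|]].
  by move=> x /andP[hx1 hx2] /sE; apply: nE; apply/andP; split; lra.
have [p [q [h3 h4 [nEp nEq [s [t [ps st tq hE]]]]]]] := hi.
exists (- q), (- p); split; [lra|lra|split; [by move=> /sE'|by move=> /sE'|]].
exists (- t), (- s); split; [lra|lra|lra|move=> x /andP[hx1 hx2]].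
by apply: sE'; apply: hE; apply/andP; split; lra.
Qed.

End Line.

(** * Endpoints of gaps of the difference set *)

Section Local.
Context {R : realType} (a : nat -> R).
Context (a01 : forall n, (0 < n)%N -> 0 < a n < 1).
Local Notation d := (dlen a).
Local Notation D := (diff_tail a).

(** Only the leftmost of the three children meets the part of D_n to the left of
    the minimum of the middle child. *)
Lemma diff_tail_near_min n (x : R) : x < - d n.+1 ->
  D n x <-> D n.+1 (x + (d n - d n.+1)).
Proof.
move=> hx; have h1 := dlenS_lt a01 n; have h2 := dlen_gt0 a01 n.+1.
split=> [/(diff_tailS a01)[//||]|h].
- by move=> /diff_tail_itv/andP[h3 h4]; exfalso; lra.
- by move=> /diff_tail_itv/andP[h3 h4]; exfalso; lra.
- by apply/(diff_tailS a01); constructor 1.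
Qed.

(** Near b, the set D_0 is the translate of D_n whose minimum is b. *)
Definition aligned (b : R) (n : nat) (e : R) :=
  forall x : R, b - e < x < b + e -> D 0 x <-> D n (x - b - d n).

Lemma alignedS b n e e' : aligned b n e -> e' <= e -> e' <= d n - d n.+1 ->
  aligned b n.+1 e'.
Proof.
move=> al ee er x /andP[h1 h2]; rewrite al; last by apply/andP; split; lra.
rewrite diff_tail_near_min; last by lra.
by rewrite (_ : x - b - d n + _ = x - b - d n.+1) //; ring.
Qed.

(** An alignment passes to all deeper levels.  The radius d_i - d_(i+1) obtained
    at level i + 1 exceeds d_(i+1), so that the window contains the leftmost
    child of D_(i+1) and the gap that follows it. *)
Lemma aligned_deep b n e : 0 < e -> aligned b n e -> forall e', 0 < e' ->
  exists N, forall i, (N <= i)%N -> aligned b i.+1 (d i - d i.+1) /\ d i < e'.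
Proof.
move=> e0 al e' e'0.
have step j : aligned b (n + j).+1 (Num.min e (d (n + j) - d (n + j).+1)).
  elim: j => [|j IH].
    by rewrite addn0; apply: alignedS al _ _; rewrite ge_min lexx ?orbT.
  rewrite addnS; apply: alignedS IH _ _; last by rewrite ge_min lexx orbT.
  rewrite le_min !ge_min lexx /=.
  have := dlenS_lt a01 (n + j); have := dlenS_lt a01 (n + j).+1.
  by have := dlen_gt0 a01 (n + j).+2 => h1 h2 h3; apply/orP; right; lra.
have [N hN] := dlen_small a01 e0; have [M hM] := dlen_small a01 e'0.
exists (n + N + M)%N => i hi; split; last by apply: hM; lia.
have := step (i - n)%N; rewrite subnKC; last lia.
rewrite min_r //; have := hN i ltac:(lia); have := dlen_gt0 a01 i.+1; lra.
Qed.

Definition has_itv (E : set R) :=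
  exists u v : R, u < v /\ forall x : R, u <= x <= v -> E x.

(** At a level i + 1 with a_(i+2) > 1/3, the leftmost child of D_(i+1) has no
    point of D_0 immediately to its left, and a gap to its right; both its gap
    and any interval inside it are within d_(i+1) of b. *)
Lemma ragged_aligned b n e : 0 < e -> aligned b n e ->
  (forall N, exists2 i, (N <= i)%N & 3 * d i.+1 < d i) ->
  (forall i, has_itv (D i)) -> ragged (D 0) b.
Proof.
move=> e0 al gapi itvs e' e'0; have [N hN] := aligned_deep e0 al e'0.
have [[//|i] Ni g] := gapi N.+1; have [{}al de] := hN i Ni.
have d1 := dlenS_lt a01 i; have d2 := dlenS_lt a01 i.+1.
have d3 := dlen_gt0 a01 i.+2.
have hole (x : R) : b + 2 * d i.+2 < x < b + (d i.+1 - d i.+2) -> ~ D 0 x.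
  move=> /andP[h1 h2]; rewrite al; last by apply/andP; split; lra.
  by move=> /(diff_tailS a01)[] /diff_tail_itv/andP[]; lra.
split.
  exists (b + 2 * d i.+2), (b + (d i.+1 - d i.+2)); split; [lra|lra|].
  split; [lra| | |exact: hole]; (rewrite al; last by apply/andP; split; lra);
    apply/(diff_tailS a01).
    by constructor 1; rewrite (_ : _ + _ = d i.+2);
      [exact: (diff_tail_end a01 _).2|ring].
  by constructor 2; rewrite (_ : _ - _ = - d i.+2);
    [exact: (diff_tail_end a01 _).1|ring].
have [u [v [uv huv]]] := itvs i.+2.
have /diff_tail_itv/andP[u1 u2] : D i.+2 u by apply: huv; rewrite lexx ltW.
have /diff_tail_itv/andP[v1 v2] : D i.+2 v by apply: huv; rewrite lexx ltW.
(* the second point is the middle of the gap after the leftmost child *)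
exists (b - d i.+2), (b + (d i.+1 + d i.+2) / 2); split; [lra|lra|split].
- rewrite al; last by apply/andP; split; lra.
  by move=> /diff_tail_itv/andP[]; lra.
- by apply: hole; apply/andP; split; lra.
exists (b + d i.+2 + u), (b + d i.+2 + v); split; [lra|lra|lra|].
move=> x /andP[x1 x2]; rewrite al; last by apply/andP; split; lra.
apply/(diff_tailS a01); constructor 1; apply: huv; apply/andP; split; lra.
Qed.

Lemma closed_avoid (E : set R) (b : R) : closed E -> ~ E b ->
  exists2 e : R, 0 < e & forall x : R, b - e < x < b + e -> ~ E x.
Proof.
move=> cE nEb; have : nbhs b (~` E).
  by apply: open_nbhs_nbhs; split => //; exact: closed_openC.
by move=> /nbhs_radius.
Qed.

(** A translate of D_(k+n) inside D_k that contains b, and is shorter than the gap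
    that ends at b, has its minimum at b.  So all translates through b coincide,
    and the finitely many others stay away from b. *)
Lemma gap_end_aligned n k (u b : R) : u < b -> D k b ->
  (forall x : R, u < x < b -> ~ D k x) ->
  2 * d (k + n) < b - u ->
  exists2 e : R, 0 < e & forall x : R, b - e < x < b + e ->
    D k x <-> D (k + n) (x - b - d (k + n)).
Proof.
elim: n k u b => [|n IH] k u b ub Db nD.
  rewrite addn0 => hu; exists 1 => // x _.
  have /diff_tail_itv/andP[b1 b2] := Db.
  suff -> : b = - d k by rewrite opprK addrK.
  apply/eqP; rewrite eq_le b1 andbT leNgt; apply/negP => h.
  apply: (nD (- d k)); last exact: (diff_tail_end a01 _).1.
  by apply/andP; split; lra.
rewrite addnS -addSn => hu; set r := d k - d k.+1.
have sub (y c : R) : D k.+1 (y - c) -> c \in [:: - r; 0; r] -> D k y.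
  rewrite !inE => h hc; apply/(diff_tailS a01); move: hc => /or3P[] /eqP cE.
  - by constructor 1; rewrite cE opprK in h.
  - by constructor 2; rewrite cE subr0 in h.
  - by constructor 3; rewrite cE in h.
(* A shifted copy of D_(k+1) either contains b, and then the induction
   hypothesis describes it near b, or avoids a neighbourhood of b. *)
have piece (c : R) : c \in [:: - r; 0; r] -> exists2 e : R, 0 < e & forall x : R,
    b - e < x < b + e -> D k.+1 (x - c) <->
    D k.+1 (b - c) /\ D (k.+1 + n) (x - b - d (k.+1 + n)).
  move=> hc; have [Dc|nDc] := pselect (D k.+1 (b - c)).
    have [||||e e0 he] := IH k.+1 (u - c) (b - c).
    - lra.
    - exact: Dc.
    - move=> x /andP[h1 h2] h; apply: (nD (x + c)); first by apply/andP; split; lra.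
      by apply: sub hc; rewrite addrK.
    - lra.
    exists e => // x /andP[h1 h2]; rewrite he; last by apply/andP; split; lra.
    rewrite (_ : x - c - (b - c) = x - b); last by ring.
    by split => [|[]].
  have [e e0 he] := closed_avoid (@closed_diff_tail _ a k.+1) nDc.
  exists e => // x /andP[h1 h2]; split => [h|[]//].
  by case: (he (x - c)) => //; apply/andP; split; lra.
have [|e1 e1_0 h1] := piece (- r); first by rewrite !inE eqxx.
have [|e2 e2_0 h2] := piece 0; first by rewrite !inE eqxx orbT.
have [|e3 e3_0 h3] := piece r; first by rewrite !inE eqxx !orbT.
exists (Num.min e1 (Num.min e2 e3)); first by rewrite !lt_min e1_0 e2_0 e3_0.
move=> x hx.
have [x1 x2 x3] : [/\ b - e1 < x < b + e1, b - e2 < x < b + e2 & b - e3 < x < b + e3].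
  have m1 : Num.min e1 (Num.min e2 e3) <= e1 by rewrite ge_min lexx.
  have m2 : Num.min e1 (Num.min e2 e3) <= e2 by rewrite !ge_min lexx orbT.
  have m3 : Num.min e1 (Num.min e2 e3) <= e3 by rewrite !ge_min lexx !orbT.
  by move: hx => /andP[? ?]; split; apply/andP; split; lra.
have {h1 x1} := h1 x x1; have {h2 x2} := h2 x x2; have {h3 x3} := h3 x x3.
rewrite !subr0 !opprK => p1 p2 p3; split.
  by move=> /(diff_tailS a01)[/p3[]|/p2[]|/p1[]].
move=> h; apply/(diff_tailS a01); move: Db => /(diff_tailS a01)[] hb.
- by constructor 1; apply/p3.
- by constructor 2; apply/p2.
- by constructor 3; apply/p1.
Qed.

Lemma diff_tail_other n k (x : R) : D k x ->
  exists y : R, [/\ D k y, y <> x & `|y - x| <= 2 * d (k + n)].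
Proof.
elim: n k x => [|n IH] k x.
  rewrite addn0 => /[dup] Dx /diff_tail_itv/andP[h1 h2].
  have d0 := dlen_gt0 a01 k; have [m M] := diff_tail_end a01 k.
  have [xd|xd] := eqVneq x (d k).
    by exists (- d k); split=> //; [lra|rewrite ler_norml; apply/andP; split; lra].
  exists (d k); split=> //; first by apply/eqP; rewrite eq_sym.
  by rewrite ler_norml; apply/andP; split; lra.
rewrite addnS -addSn => /(diff_tailS a01)[] /IH[y [Dy yx ylen]].
- exists (y - (d k - d k.+1)); split; last 1 first.
  + rewrite (_ : _ - _ = y - (x + (d k - d k.+1))) //; ring.
  + by apply/(diff_tailS a01); constructor 1; rewrite subrK.
  + by move=> e; apply: yx; rewrite -e subrK.
- by exists y; split=> //; apply/(diff_tailS a01); constructor 2.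
- exists (y + (d k - d k.+1)); split; last 1 first.
  + rewrite (_ : _ - _ = y - (x - (d k - d k.+1))) //; ring.
  + by apply/(diff_tailS a01); constructor 3; rewrite addrK.
  + by move=> e; apply: yx; rewrite -e addrK.
Qed.

(** An interval inside some D_i makes every D_k with k <= i contain an interval,
    which is why intervals are required only at arbitrarily deep levels. *)
Lemma diff_tail_cantorval :
  (forall N, exists2 i, (N <= i)%N & 3 * d i.+1 < d i) ->
  (forall N, exists2 i, (N <= i)%N & has_itv (D i)) -> cantorval (D 0).
Proof.
move=> gapi itvi; have itvs k : has_itv (D k).
  have [i /subnK <-] := itvi k; elim: (i - k)%N => [//|j IH]; rewrite addSn.
  move=> [u [v [uv huv]]]; apply: IH; exists u, v; split=> // x /huv h.
  by apply/(diff_tailS a01); constructor 2.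
have gap_right (u v : R) : gap_between (D 0) u v -> ragged (D 0) v.
  move=> [uv Du Dv nD].
  have [N hN] := @dlen_small _ _ a01 ((v - u) / 2) ltac:(lra).
  have h2 : 2 * d (0 + N) < v - u by have := hN N (leqnn N); rewrite add0n; lra.
  have [e e0 al] := gap_end_aligned uv Dv nD h2.
  exact: ragged_aligned e0 al gapi itvs.
apply: cantorval_ragged.
- exact: closed_diff_tail.
- move=> x Dx e e0; have [N hN] := @dlen_small _ _ a01 (e / 2) ltac:(lra).
  have [y [Dy yx ylen]] := diff_tail_other N Dx; exists y; split=> //.
  by have := hN N (leqnn N); rewrite add0n in ylen; lra.
- move=> u v /[dup] [[uv Du Dv nD]] /gap_right rv; split=> //.
  rewrite -[u]opprK; apply: ragged_opp; first exact: diff_tailN.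
  apply: (gap_right (- v)); split; [lra|exact: diff_tailN|exact: diff_tailN|].
  by move=> x /andP[h1 h2] /diff_tailN; apply: nD; apply/andP; split; lra.
- exists (- d 0); apply: (@ragged_aligned _ 0 1) => // x _.
  by rewrite opprK addrK.
Qed.

End Local.

(** * Intervals with gaps removed near both ends *)

Section Trim.
Context {R : realType}.
Implicit Types (A : set R) (c e s x : R).

(** One set A, of distances from an end, describes both ends, because the sets
    D_k are symmetric. *)
Definition trim A c : set R :=
  [set x | [/\ - c <= x <= c, ~ A (x + c) & ~ A (c - x)]].

(** Three disjoint intervals of half-length e in one of half-length c, each
    trimmed by A.  Seen from the left end of the large interval, the gaps are
    the first one between two children, those at both ends of the left child,
    and those at the left end of the middle child; the remaining ones are seen
    from the right end. *)
Lemma trim_separate A c e s x : 0 < e -> 3 * e < c -> s <= e ->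
  (forall y, A y -> 0 < y < s) ->
  trim [set y | [\/ 2 * e < y < c - e, A y, A (2 * e - y) | A (y - (c - e))]] c x <->
  [\/ trim A e (x + (c - e)), trim A e x | trim A e (x - (c - e))].
Proof.
move=> e0 ec se bA; rewrite /trim /=.
have neg y z : y = z -> ~ A y -> ~ A z by move=> ->.
split.
  move=> [/andP[x1 x2] nl nr].
  have {}nl : [/\ ~ (2 * e < x + c < c - e), ~ A (x + c), ~ A (2 * e - (x + c)) &
      ~ A (x + c - (c - e))].
    by split=> h; apply: nl; [constructor 1|constructor 2|constructor 3|constructor 4].
  have {}nr : [/\ ~ (2 * e < c - x < c - e), ~ A (c - x), ~ A (2 * e - (c - x)) &
      ~ A (c - x - (c - e))].
    by split=> h; apply: nr; [constructor 1|constructor 2|constructor 3|constructor 4].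
  move: nl nr => [l1 l2 l3 l4] [r1 r2 r3 r4].
  have [h1|h1] := leP (x + c) (2 * e).
    constructor 1; split; first by apply/andP; split; lra.
      by apply: neg l2; ring.
    by apply: neg l3; ring.
  have [h2|h2] := ltP (x + c) (c - e); first by case: l1; rewrite h1 h2.
  have [h3|h3] := leP (c - x) (2 * e).
    constructor 3; split; first by apply/andP; split; lra.
      by apply: neg r3; ring.
    by apply: neg r2; ring.
  have [h4|h4] := ltP (c - x) (c - e); first by case: r1; rewrite h3 h4.
  constructor 2; split; first by apply/andP; split; lra.
    by apply: neg l4; ring.
  by apply: neg r4; ring.
by case=> -[/andP[x1 x2] nl nr]; split; (try by apply/andP; split; lra);
  case=> [/andP[h1 h2]|/[dup] h /bA/andP[h1 h2]|/[dup] h /bA/andP[h1 h2]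
         |/[dup] h /bA/andP[h1 h2]]; try lra;
  solve [refine (neg _ _ _ nl h); ring | refine (neg _ _ _ nr h); ring].
Qed.

(** When neighbouring children overlap, a point removed from the left child near
    its right end, at distance y from it, is at distance 3 * e - c - y from the
    left end of the middle child.  It survives there unless both distances
    belong to A; all other removed points are out of reach of the neighbours. *)
Lemma trim_overlap A c e s x : 0 < e -> 2 * e < c -> 0 <= s <= e ->
  s <= 3 * e - c ->
  (forall y, A y -> 0 < y < s) ->
  (forall y z, A y -> A z -> y + z <> 3 * e - c) ->
  trim A c x <->
  [\/ trim A e (x + (c - e)), trim A e x | trim A e (x - (c - e))].
Proof.
move=> e0 ec /andP[s0 se] sl bA key; rewrite /trim /=.
have no y : ~~ (0 < y < s) -> ~ A y by move=> /negP h /bA.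
have neg y z : y = z -> ~ A y -> ~ A z by move=> ->.
split; last first.
  by case=> -[/andP[x1 x2] nl nr]; split; (try by apply/andP; split; lra);
    move=> /[dup] h /bA/andP[h1 h2]; try lra;
    solve [refine (neg _ _ _ nl h); ring | refine (neg _ _ _ nr h); ring].
move=> [/andP[x1 x2] nl nr].
have far y : s <= y -> ~ A y by move=> h; apply: no; rewrite negb_and -!leNgt h orbT.
have [h1|h1] := leP x (2 * e - c).
  have [h2|h2] := pselect (A (2 * e - (x + c))); last first.
    constructor 1; split; first by apply/andP; split; lra.
      by apply: neg nl; ring.
    by apply: neg h2; ring.
  have /andP[h3 h4] := bA _ h2.
  constructor 2; split; first by apply/andP; split; lra.
    by move=> h5; case: (key _ _ h2 h5); ring.
  by apply: far; lra.
have [h1'|h1'] := leP (c - 2 * e) x.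
  have [h2|h2] := pselect (A (2 * e - (c - x))); last first.
    constructor 3; split; first by apply/andP; split; lra.
      by apply: neg h2; ring.
    by apply: neg nr; ring.
  have /andP[h3 h4] := bA _ h2.
  constructor 2; split; first by apply/andP; split; lra.
    by apply: far; lra.
  by move=> h5; case: (key _ _ h2 h5); ring.
constructor 2; split; first by apply/andP; split; lra.
  by apply: far; lra.
by apply: far; lra.
Qed.

End Trim.

(** * The difference set as an interval without its edge gaps *)

Section EdgeGaps.
Context {R : realType} (a : nat -> R) (kk : nat -> nat).
Context (a01 : forall n, (0 < n)%N -> 0 < a n < 1).
Local Notation d := (dlen a).

(** The distance between the centres of neighbouring children at level kk m. *)
Definition jump (m : nat) : R := d (kk m).-1 - d (kk m).

(** The gaps (u, v) of generation j at the left end, placed at 0, of an interval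
    of level k with kk m.-1 <= k < kk m.  Inside the leftmost subinterval of level
    (kk m).-1 the first gap separates the left child from the middle one; a later
    gap sits at the left end or at the right end of that left child, or at the
    left end of the middle child. *)
Fixpoint cell (j m : nat) (u v : R) : Prop :=
  if j is j'.+1 then
    [\/ cell j' m.+1 u v,
        cell j' m.+1 (2 * d (kk m) - v) (2 * d (kk m) - u) |
        cell j' m.+1 (u - jump m) (v - jump m)]
  else u = 2 * d (kk m) /\ v = jump m.

Definition level (j m : nat) : set R :=
  [set x | exists u v, cell j m u v /\ u < x < v].

Definition edge_gaps (m : nat) : set R := \bigcup_j level j m.

Lemma level0 m : level 0 m = [set x | 2 * d (kk m) < x < jump m].
Proof.
apply/seteqP; split=> x /=; first by move=> [u [v [[-> ->]]]].
by exists (2 * d (kk m)), (jump m).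
Qed.

Lemma levelS j m : level j.+1 m = [set x | [\/ level j m.+1 x,
  level j m.+1 (2 * d (kk m) - x) | level j m.+1 (x - jump m)]].
Proof.
apply/seteqP; split=> x /=.
  move=> [u [v [[c|c|c] /andP[h1 h2]]]].
  - by constructor 1; exists u, v; rewrite h1 h2.
  - constructor 2; exists (2 * d (kk m) - v), (2 * d (kk m) - u); split=> //.
    by apply/andP; split; lra.
  - constructor 3; exists (u - jump m), (v - jump m); split=> //.
    by apply/andP; split; lra.
case=> -[u [v [c /andP[h1 h2]]]].
- by exists u, v; split; [constructor 1|rewrite h1 h2].
- exists (2 * d (kk m) - v), (2 * d (kk m) - u); split.
    by constructor 2; rewrite !subKr.
  by apply/andP; split; lra.
- exists (u + jump m), (v + jump m); split; first by constructor 3; rewrite !addrK.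
  by apply/andP; split; lra.
Qed.

Lemma edge_gapsE m : edge_gaps m =
  [set x | [\/ 2 * d (kk m) < x < jump m, edge_gaps m.+1 x,
    edge_gaps m.+1 (2 * d (kk m) - x) | edge_gaps m.+1 (x - jump m)]].
Proof.
apply/seteqP; split=> x /=.
  move=> [[|j] _]; first by rewrite level0; constructor 1.
  by rewrite levelS => -[] h; [constructor 2|constructor 3|constructor 4]; exists j.
case=> [h|[j _ h]|[j _ h]|[j _ h]]; first by exists 0%N; rewrite ?level0.
all: exists j.+1 => //; rewrite levelS.
- by constructor 1.
- by constructor 2.
- by constructor 3.
Qed.

Lemma open_edge_gaps m : open (edge_gaps m).
Proof.
apply: bigcup_open => j _; rewrite openE => x [u [v [c h]]].
have : nbhs x [set` `]u, v[].
  apply: open_nbhs_nbhs; split; first exact: interval_open.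
  by rewrite /= in_itv.
by apply: filterS => y /=; rewrite in_itv /= => hy; exists u, v.
Qed.

Lemma closed_trim_edge_gaps m c : closed (trim (edge_gaps m) c).
Proof.
rewrite (_ : trim _ c = [set` `[- c, c]] `&` (fun x => x + c) @^-1` (~` edge_gaps m)
   `&` (fun x => c - x) @^-1` (~` edge_gaps m)).
  have cC : closed (~` edge_gaps m) by apply: open_closedC; exact: open_edge_gaps.
  apply: closedI; first apply: closedI; first exact: interval_closed.
    apply: preimage_closed cC => x _.
    by apply: cvgD; [exact: cvg_id|exact: cvg_cst].
  apply: preimage_closed cC => x _.
  by apply: cvgB; [exact: cvg_cst|exact: cvg_id].
by apply/seteqP; split=> x /=; rewrite in_itv /=; [case|case=> -[]].
Qed.

Context (kk_lt : forall n, (kk n < kk n.+1)%N).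

Lemma jump_ge0 m : 0 <= jump m.
Proof. by rewrite subr_ge0; apply: dlen_le => //; lia. Qed.

(** The sum of jump i over i >= m: how far the gaps at an end can reach. *)
Definition jumps (m : nat) : R := fine (\sum_(m <= i <oo) (jump i)%:E).

(** The sum is bounded by a telescoping one, as kk i <= (kk i.+1).-1. *)
Lemma sum_jump_le m n : (0 < m)%N -> \sum_(m <= i < n) jump i <= d (kk m).-1.
Proof.
move=> m0; have d0 i := dlen_gt0 a01 i.
have [nm|/ltnW/subnKC <-] := leqP n m; first by rewrite big_geq // ltW.
suff : \sum_(m <= i < m + (n - m)) jump i + d (kk (m + (n - m))).-1 <= d (kk m).-1.
  by have := d0 (kk (m + (n - m))).-1; lra.
elim: (n - m)%N => [|j IH]; first by rewrite addn0 big_geq // add0r.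
rewrite addnS big_nat_recr ?leq_addr //=; apply: le_trans IH.
rewrite -addrA lerD2l /jump.
have : d (kk (m + j).+1).-1 <= d (kk (m + j)).
  by apply: dlen_le => //; have := kk_lt (m + j); lia.
lra.
Qed.

Lemma jumpsE m : (0 < m)%N ->
  (\sum_(m <= i <oo) (jump i)%:E = (jumps m)%:E)%E /\ jumps m <= d (kk m).-1.
Proof.
move=> m0.
have ge0 : (0 <= \sum_(m <= i <oo) (jump i)%:E)%E.
  by apply: nneseries_ge0 => i _ _; rewrite lee_fin jump_ge0.
have le : (\sum_(m <= i <oo) (jump i)%:E <= (d (kk m).-1)%:E)%E.
  apply: lime_le.
    by apply: is_cvg_nneseries => i _ _; rewrite lee_fin jump_ge0.
  by apply: nearW => n; rewrite sumEFin lee_fin sum_jump_le.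
have e : (\sum_(m <= i <oo) (jump i)%:E = (jumps m)%:E)%E.
  rewrite /jumps fineK // ge0_fin_numE //; apply: le_lt_trans le _; exact: ltry.
by split=> //; rewrite -lee_fin -e.
Qed.

Lemma jumps_ge0 m : 0 <= jumps m.
Proof.
apply: fine_ge0; apply: nneseries_ge0 => i _ _; by rewrite lee_fin jump_ge0.
Qed.

Lemma jumpsS m : (0 < m)%N -> jumps m = jump m + jumps m.+1.
Proof.
move=> m0; apply: EFin_inj; rewrite EFinD -(jumpsE m0).1 -(jumpsE (ltn0Sn m)).1.
rewrite (@nneseries_split _ _ m 1); last by move=> i _; rewrite lee_fin jump_ge0.
by rewrite addn1 big_nat1.
Qed.

Lemma jumps_le m k : (0 < m)%N -> (k < kk m)%N -> jumps m <= d k.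
Proof.
move=> m0 km; apply: le_trans (jumpsE m0).2 _; apply: dlen_le => //; lia.
Qed.

Context (kk_gap : forall n, (0 < n)%N -> 3 * d (kk n) < d (kk n).-1).

Lemma level_itv j m (x : R) : (0 < m)%N -> level j m x -> 0 < x < jumps m.
Proof.
elim: j m x => [|j IH] m x m0; have d0 := dlen_gt0 a01 (kk m).
all: have S := jumpsS m0; have s0 := jumps_ge0 m.+1.
all: have g := kk_gap m0; have s1 := jumps_le (ltn0Sn m) (kk_lt m).
  by rewrite level0 /= => /andP[h1 h2]; apply/andP; split; lra.
rewrite levelS => -[] /(IH _ _ (ltn0Sn m))/andP[h1 h2];
  have j0 := jump_ge0 m; rewrite /jump in S j0 h1 h2 *; apply/andP; split; lra.
Qed.

Lemma edge_gaps_itv m (x : R) : (0 < m)%N -> edge_gaps m x -> 0 < x < jumps m.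
Proof. by move=> m0 [j _ /(level_itv m0)]. Qed.

Context (kk_margin : forall m i, (0 < m)%N -> (kk m.-1 < i < kk m)%N ->
  jump m + 2 * jumps m.+1 <= 3 * d i - d i.-1 /\
  3 * d i - d i.-1 <= 4 * d (kk m) - 2 * jumps m.+1).

Lemma trim_edge_gapsS_gap m k : (0 < m)%N -> kk m = k.+1 -> forall x : R,
  trim (edge_gaps m) (d k) x <->
  [\/ trim (edge_gaps m.+1) (d k.+1) (x + (d k - d k.+1)),
      trim (edge_gaps m.+1) (d k.+1) x |
      trim (edge_gaps m.+1) (d k.+1) (x - (d k - d k.+1))].
Proof.
move=> m0 km x; rewrite edge_gapsE /jump km /=; apply: trim_separate.
- exact: dlen_gt0.
- by have := kk_gap m0; rewrite km.
- by apply: (jumps_le (ltn0Sn m)); rewrite -km kk_lt.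
- by move=> y; exact: edge_gaps_itv.
Qed.

(** A point of [edge_gaps m] is either below jumps m.+1 or within that distance
    of the first gap.  Two points of the second kind add up to more than every
    overlap, and any other two to less. *)
Lemma edge_gaps_add m i (y z : R) : (0 < m)%N -> (kk m.-1 < i < kk m)%N ->
  edge_gaps m y -> edge_gaps m z -> y + z <> 3 * d i - d i.-1.
Proof.
move=> m0 hi; have [h1 h2] := kk_margin m0 hi.
have d0 := dlen_gt0 a01 (kk m).
have s1 := jumps_le (ltn0Sn m) (kk_lt m); have s0 := jumps_ge0 m.+1.
have j0 : 2 * d (kk m) < jump m by have := kk_gap m0; rewrite /jump; lra.
have small (t : R) : edge_gaps m t -> 0 < t < jumps m.+1 \/
    2 * d (kk m) - jumps m.+1 < t < jump m + jumps m.+1.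
  rewrite edge_gapsE /=.
  case=> [/andP[? ?]|/(edge_gaps_itv (ltn0Sn m))/andP[? ?]|
    /(edge_gaps_itv (ltn0Sn m))/andP[? ?]|/(edge_gaps_itv (ltn0Sn m))/andP[? ?]];
    [right|left|right|right]; apply/andP; split; lra.
by move=> /small[]/andP[y1 y2] /small[]/andP[z1 z2] e; lra.
Qed.

Lemma trim_edge_gapsS_overlap m k : (0 < m)%N -> (kk m.-1 < k.+1 < kk m)%N ->
  forall x : R, trim (edge_gaps m) (d k) x <->
  [\/ trim (edge_gaps m) (d k.+1) (x + (d k - d k.+1)),
      trim (edge_gaps m) (d k.+1) x |
      trim (edge_gaps m) (d k.+1) (x - (d k - d k.+1))].
Proof.
move=> m0 hk x; have [h1 h2] := kk_margin m0 hk; have s0 := jumps_ge0 m.+1.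
apply: (@trim_overlap _ _ _ _ (jumps m)).
- exact: dlen_gt0.
- exact: dlenS_lt.
- by rewrite jumps_ge0 (jumps_le m0) //; case/andP: hk.
- by rewrite (jumpsS m0) /=; rewrite /= in h1; lra.
- by move=> y; exact: edge_gaps_itv.
- by move=> y z; exact: edge_gaps_add.
Qed.

Lemma kk_mono m n : (m <= n)%N -> (kk m <= kk n)%N.
Proof.
move=> /subnK <-; elim: (n - m)%N => [//|i IH]; rewrite addSn.
exact: leq_trans IH (ltnW (kk_lt _)).
Qed.

Lemma kk_ge n : (n <= kk n)%N.
Proof. by elim: n => [//|n IH]; exact: leq_ltn_trans IH (kk_lt n). Qed.

Lemma kk_phase k : (kk 0 <= k)%N -> exists2 m, (0 < m)%N & (kk m.-1 <= k < kk m)%N.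
Proof.
move=> hk; have ex : exists n, (k < kk n)%N.
  by exists k.+1; exact: kk_ge.
have [m km min] := ex_minnP ex.
have m0 : (0 < m)%N by case: m km {min} => // /leq_trans/(_ hk); rewrite ltnn.
exists m => //; rewrite km andbT leqNgt; apply/negP => /min; lia.
Qed.

Lemma kk_phase_inj k m n : (0 < m)%N -> (0 < n)%N ->
  (kk m.-1 <= k < kk m)%N -> (kk n.-1 <= k < kk n)%N -> m = n.
Proof.
move=> m0 n0 hm hn; apply/eqP; rewrite eqn_leq; apply/andP; split.
  by rewrite leqNgt; apply/negP => nm; have := @kk_mono n m.-1 ltac:(lia); lia.
by rewrite leqNgt; apply/negP => nm; have := @kk_mono m n.-1 ltac:(lia); lia.
Qed.

(** The predicted form of D_k.  The phase m is quantified existentially, so that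
    the sets form a family indexed by the level alone. *)
Definition trimmed k : set R := [set x | exists m,
  [/\ (0 < m)%N, (kk m.-1 <= k < kk m)%N & trim (edge_gaps m) (d k) x]].

Lemma trimmedE k m : (0 < m)%N -> (kk m.-1 <= k < kk m)%N ->
  trimmed k = trim (edge_gaps m) (d k).
Proof.
move=> m0 hm; apply/seteqP; split=> x; last by exists m.
by move=> [n [n0 hn]]; rewrite (kk_phase_inj m0 n0 hm hn).
Qed.

Lemma trimmedS k (x : R) : (kk 0 <= k)%N -> trimmed k x <->
  [\/ trimmed k.+1 (x + (d k - d k.+1)), trimmed k.+1 x |
      trimmed k.+1 (x - (d k - d k.+1))].
Proof.
move=> /kk_phase[m m0 hm]; rewrite (trimmedE m0 hm).
have [/eqP km|km] := boolP (kk m == k.+1).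
  rewrite (@trimmedE k.+1 m.+1) //; last by rewrite /= km leqnn -km kk_lt.
  exact: trim_edge_gapsS_gap.
rewrite (@trimmedE k.+1 m) //; last by lia.
by apply: trim_edge_gapsS_overlap => //; lia.
Qed.

Lemma trimmed_end k : (kk 0 <= k)%N -> trimmed k (d k).
Proof.
move=> /kk_phase[m m0 hm]; exists m; split=> //.
have d0 := dlen_gt0 a01 k; have s := jumps_le m0 (proj2 (andP hm)).
split; first by apply/andP; split; lra.
  by move=> /(edge_gaps_itv m0)/andP[]; lra.
by move=> /(edge_gaps_itv m0)/andP[]; lra.
Qed.

(** Unfolding the recursion n times, a point of X k is a finite sum of shifts plus
    a point of X (k + n), and the same shifts lead from a point of Y (k + n) to a
    point of Y k; these two points differ by at most the length 2 * dlen a (k + n). *)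
Lemma ternary_approx (X Y : nat -> set R) K :
  (forall k, (K <= k)%N -> forall x, X k x ->
     [\/ X k.+1 (x + (d k - d k.+1)), X k.+1 x | X k.+1 (x - (d k - d k.+1))]) ->
  (forall k, (K <= k)%N -> forall x,
     [\/ Y k.+1 (x + (d k - d k.+1)), Y k.+1 x | Y k.+1 (x - (d k - d k.+1))] ->
     Y k x) ->
  (forall k, (K <= k)%N -> forall x, X k x -> - d k <= x <= d k) ->
  (forall k, (K <= k)%N -> Y k (d k)) ->
  forall k, (K <= k)%N -> X k `<=` closure (Y k).
Proof.
move=> XS YS Xb Yd k Kk x Xx V /nbhs_radius[e e0 he].
have approx n : forall k y, (K <= k)%N -> X k y ->
    exists z : R, Y k z /\ `|z - y| <= 2 * d (k + n).
  elim: n => [|n IH] {Kk x Xx he} k y Kk.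
    move=> /(Xb k Kk)/andP[y1 y2]; exists (d k); split; first exact: Yd.
    by rewrite addn0 ler_norml; apply/andP; split; lra.
  have Kk' : (K <= k.+1)%N by exact: leqW.
  rewrite addnS -addSn => /(XS k Kk)[] /(IH k.+1 _ Kk')[z [Yz hz]].
  - exists (z - (d k - d k.+1)); split.
      by apply: (YS k Kk); constructor 1; rewrite subrK.
    by rewrite (_ : _ - y = z - (y + (d k - d k.+1))) //; ring.
  - by exists z; split=> //; apply: (YS k Kk); constructor 2.
  - exists (z + (d k - d k.+1)); split.
      by apply: (YS k Kk); constructor 3; rewrite addrK.
    by rewrite (_ : _ - y = z - (y - (d k - d k.+1))) //; ring.
have [N hN] := @dlen_small _ _ a01 (e / 2) ltac:(lra).
have [z [Yz hz]] := approx N k x Kk Xx; exists z; split => //; apply: he.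
have := hN (k + N)%N (leq_addl _ _); move: hz; rewrite ler_norml => /andP[h1 h2] h3.
by apply/andP; split; lra.
Qed.

Lemma diff_tail_trimmed k : (kk 0 <= k)%N -> diff_tail a k = trimmed k.
Proof.
move=> hk; have cT : closed (trimmed k).
  have [m m0 hm] := kk_phase hk; rewrite (trimmedE m0 hm).
  exact: closed_trim_edge_gaps.
apply/seteqP; split.
  apply: subset_trans cT; apply: (@ternary_approx _ _ (kk 0)) hk.
  - by move=> i _ x /(diff_tailS a01).
  - by move=> i hi x /(trimmedS _ hi).
  - by move=> i _ x /diff_tail_itv.
  - by move=> i; exact: trimmed_end.
apply: subset_trans (@closed_diff_tail _ a k).
apply: (@ternary_approx _ _ (kk 0)) hk.
- by move=> i hi x /(trimmedS _ hi).
- by move=> i _ x /(diff_tailS a01).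
- by move=> i _ x [m [_ _ []]].
- by move=> i _; exact: (diff_tail_end a01 _).2.
Qed.

Context (kk_first : ((kk 0).+1 < kk 1)%N).

(** If kk n.+1 = (kk n).+1, then passing from n to n.+1 lowers both sides by
    jump n.+1.  Otherwise the overlap at level i = (kk n.+1).-1 is shorter than
    dlen a i = jump n.+1 + dlen a (kk n.+1), while it is at least
    jump n.+1 + 2 * jumps n.+2. *)
Lemma jumps_lt n : jumps n.+1 < d (kk n).
Proof.
elim: n => [|n IH].
  apply: le_lt_trans (jumps_le (ltn0Sn 0) kk_first) _.
  by have := dlenS_lt a01 (kk 0); have := dlen_gt0 a01 (kk 0).+1; lra.
have [/eqP e|ne] := boolP (kk n.+1 == (kk n).+1).
  by move: IH; rewrite (jumpsS (ltn0Sn n)) /jump {1}e /=; lra.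
have [||h _] := @kk_margin n.+1 (kk n.+1).-1; first by [].
  by have /= := kk_lt n; lia.
have := kk_lt n; move: h; rewrite /jump; case: (kk n.+1) ne => [|[|i]] ne //= h lt.
  by lia.
have := dlenS_lt a01 i; have := dlen_gt0 a01 i.+2; have := jumps_ge0 n.+2; lra.
Qed.

Lemma diff_tail_has_itv N : exists2 i, (N <= i)%N & has_itv (diff_tail a i).
Proof.
exists (kk N); first exact: kk_ge.
have h := jumps_lt N.
rewrite diff_tail_trimmed; last exact: kk_mono.
rewrite (@trimmedE _ N.+1) //; last by rewrite /= leqnn kk_lt.
exists (- (d (kk N) - jumps N.+1)), (d (kk N) - jumps N.+1); split; first lra.
have s0 := jumps_ge0 N.+1.
move=> x /andP[x1 x2]; split; first by apply/andP; split; lra.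
  by move=> /(edge_gaps_itv (ltn0Sn N))/andP[]; lra.
by move=> /(edge_gaps_itv (ltn0Sn N))/andP[]; lra.
Qed.

End EdgeGaps.

(** * The families of gaps and the measure *)

Section Families.
Context {R : realType} (a : nat -> R) (kk : nat -> nat).
Context (a01 : forall n, (0 < n)%N -> 0 < a n < 1).
Local Notation d := (dlen a).

Lemma itv_oo_congr (u v x y : R) : u = x -> v = y ->
  [set` `]u, v[] = [set` `]x, y[].
Proof. by move=> -> ->. Qed.

Lemma Jends_rcons s i : Jends a (rcons s i) = Jchild a (size s) (Jends a s) i.
Proof.
suff h n J : descend (Jchild a) n J (rcons s i) =
    Jchild a (n + size s) (descend (Jchild a) n J s) i by exact: h.
by elim: s n J => [|x s IH] n J /=; rewrite ?addn0 // IH addnS.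
Qed.

Lemma Jends_len s : (Jends a s).2 = (Jends a s).1 + 2 * d (size s).
Proof.
elim/last_ind: s => [|s i IH]; first by rewrite /Jends /= dlen0; ring.
rewrite Jends_rcons size_rcons /Jchild /Defs.center.
by case: ifP => _ /=; [ring|case: ifP => _ /=; [ring|rewrite IH; ring]].
Qed.

Lemma Jends_pad_left s n : (Jends a (s ++ nseq n (pad ord0))).1 = (Jends a s).1.
Proof.
elim: n => [|n IH]; first by rewrite cats0.
by rewrite -[n.+1]addn1 nseqD catA cats1 Jends_rcons /pad eqxx /= IH.
Qed.

Lemma Jends_pad_right s n : (Jends a (s ++ nseq n (pad ord_max))).2 = (Jends a s).2.
Proof.
elim: n => [|n IH]; first by rewrite cats0.
by rewrite -[n.+1]addn1 nseqD catA cats1 Jends_rcons /pad /= IH.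
Qed.

(** Both ends of J_s carry the same system of gaps; u and v are distances from the
    left end if j = 0, and from the right end if j = 1, measured inwards. *)
Definition anchored (j : 'I_2) (s : seq 'I_3) (u v : R) : set R :=
  if j == ord0 then [set` `](Jends a s).1 + u, (Jends a s).1 + v[]
  else [set` `](Jends a s).2 - v, (Jends a s).2 - u[].

Lemma ord2P (j : 'I_2) : j = ord0 \/ j = ord_max.
Proof. by case: j => -[|[|//]] lj; [left|right]; exact/val_inj. Qed.

Lemma gapE j s m : (size s).+1 = kk m ->
  gap a j s = anchored j s (2 * d (kk m)) (jump a kk m).
Proof.
move=> ss; rewrite /gap /anchored !Jends_rcons /jump -ss /=.
have := Jends_len s; have := @dlenS _ a (size s).
case: j => -[|[|//]] lj; rewrite /Jchild /Defs.center /= => e1 e2.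
  by rewrite e2; apply: itv_oo_congr; field.
by rewrite e2; apply: itv_oo_congr; field.
Qed.

Lemma size_padto j (t : seq 'I_3) n : (size t < kk n)%N ->
  (size (padto kk j t n)).+1 = kk n.
Proof. by move=> h; rewrite size_cat size_nseq; lia. Qed.

Lemma gapbarE j t n : (size t < kk n)%N ->
  gapbar a kk j t n = anchored j t (2 * d (kk n)) (jump a kk n).
Proof.
move=> h; rewrite /gapbar (gapE j (size_padto j h)) /anchored.
case: (ord2P j) => ->; rewrite /padto /=.
  by rewrite Jends_pad_left.
by rewrite Jends_pad_right.
Qed.

Local Notation cell := (cell a kk).
Local Notation jump := (jump a kk).

Lemma cell_congr j m u v u' v' : u = u' -> v = v' -> cell j m u v -> cell j m u' v'.
Proof. by move=> -> ->. Qed.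

Lemma cell_main i m : cell i m (2 * d (kk (m + i))) (jump (m + i)).
Proof.
elim: i m => [|i IH] m; first by rewrite addn0.
by constructor 1; rewrite addnS -addSn.
Qed.

(** The self-similar system of gaps is closed under the generation rule of the
    families: each gap creates, at every later level, one gap on each side. *)
Lemma cell_sides j i m u v : (j < i)%N -> cell j m u v ->
  cell i m (u - jump (m + i)) (u - 2 * d (kk (m + i))) /\
  cell i m (v + 2 * d (kk (m + i))) (v + jump (m + i)).
Proof.
elim: j i m u v => [|j IH] [//|i] m u v ji; rewrite addnS -addSn /=.
  move=> [-> ->]; split; [constructor 2|constructor 3].
    by rewrite !subKr; exact: cell_main.
  by rewrite ![jump m + _]addrC !addrK; exact: cell_main.
case=> /(IH i _ _ _ ji)[c1 c2]; split.
- by constructor 1.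
- by constructor 1.
- by constructor 2; apply: cell_congr c2; ring.
- by constructor 2; apply: cell_congr c1; ring.
- by constructor 3; apply: cell_congr c1; ring.
- by constructor 3; apply: cell_congr c2; ring.
Qed.

Context (kk_lt : forall n, (kk n < kk n.+1)%N).
Context (kk_gap : forall n, (0 < n)%N -> 3 * d (kk n) < d (kk n).-1).

Lemma cell_lt j m u v : (0 < m)%N -> cell j m u v -> u < v.
Proof.
elim: j m u v => [|j IH] m u v m0 /=; last by case=> /(IH m.+1 _ _ isT); lra.
by move=> [-> ->]; have := kk_gap m0; rewrite /jump; lra.
Qed.

Lemma itv_oo_inj (u v x y : R) : u < v ->
  [set` `]x, y[] = [set` `]u, v[] -> x = u /\ y = v.
Proof.
move=> uv e; have xy : x < y.
  have : [set` `]x, y[] ((u + v) / 2) by rewrite e /= in_itv /=; apply/andP; split; lra.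
  by rewrite /= in_itv /= => /andP[]; lra.
split.
  by rewrite -[x](@inf_itv _ (BLeft y) false) ?bnd_simp // e inf_itv ?bnd_simp.
by rewrite -[y](@sup_itv _ (BRight x) true) ?bnd_simp // e sup_itv ?bnd_simp.
Qed.

(** A word representing a gap is not unique, but the gap determines the endpoints
    of the two children that bound it, and these are all that the new gaps
    depend on. *)
Lemma gap_family_cell j s m n U : (0 < m)%N -> (size s).+1 = kk m ->
  gap_family a kk j s m n U -> (m <= n)%N /\
    exists u v, cell (n - m) m u v /\ U = anchored j s u v.
Proof.
move=> m0 ss; have lt_kk l k : (l <= k)%N -> (kk l < kk k.+1)%N.
  by move=> lk; exact: leq_ltn_trans (kk_mono kk_lt lk) (kk_lt k).
elim=> {n U} [|n mn|n l i t /andP[ml ln] st _ [_ [u [v [c e]]]]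
                   |n l i t /andP[ml ln] st _ [_ [u [v [c e]]]]].
- split=> //; exists (2 * d (kk m)), (jump m); rewrite subnn; split=> //.
  exact: gapE.
- split; first exact: leqW.
  exists (2 * d (kk n.+1)), (jump n.+1); split.
    by have := cell_main (n.+1 - m) m; rewrite subnKC // leqW.
  by apply: gapbarE; have := lt_kk m n mn; lia.
all: have nm : (m <= n.+1)%N by lia.
all: have [] := cell_sides (_ : (l - m < n.+1 - m)%N) c; first by lia.
all: rewrite subnKC // => c1 c2; split=> //.
all: have l0 : (0 < kk l)%N by have := kk_ge kk_lt l; lia.
all: have lkk := lt_kk l n ln.
all: rewrite gapbarE; last by rewrite size_rcons st; lia.
all: move: e; rewrite /gap /anchored; case: ifP => _ /(itv_oo_inj _)[];
  try (by have := cell_lt m0 c; lra); move=> e1 e2.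
- exists (u - jump n.+1), (u - 2 * d (kk n.+1)); split=> //=.
  by rewrite e1; apply: itv_oo_congr; ring.
- exists (v + 2 * d (kk n.+1)), (v + jump n.+1); split=> //=.
  by rewrite e1; apply: itv_oo_congr; ring.
- exists (v + 2 * d (kk n.+1)), (v + jump n.+1); split=> //=.
  by rewrite e2; apply: itv_oo_congr; ring.
- exists (u - jump n.+1), (u - 2 * d (kk n.+1)); split=> //=.
  by rewrite e2; apply: itv_oo_congr; ring.
Qed.

(** A gap started at the next level by an end of J_t generates only gaps of the
    given family, as soon as all first gaps at that end belong to it. *)
Lemma gap_family_sub j s m j' t n U : (size t < kk m.+1)%N ->
  (forall n', (m < n')%N -> gap_family a kk j s m n' (gapbar a kk j' t n')) ->
  gap_family a kk j' (padto kk j' t m.+1) m.+1 n U -> gap_family a kk j s m n U.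
Proof.
move=> st seed; elim=> {n U} [|n mn|n l i w /andP[ml ln] sw _ g
                                  |n l i w /andP[ml ln] sw _ g].
- exact: seed.
- rewrite /gapbar (_ : padto kk j' (padto kk j' t m.+1) n.+1 = padto kk j' t n.+1).
    by apply: seed; exact: leqW.
  have := kk_mono kk_lt (leqW mn) => h.
  rewrite /padto -catA -nseqD; congr (_ ++ nseq _ _).
  by rewrite size_cat size_nseq; lia.
- by apply: gap_family_left g; rewrite // ln andbT ltnW.
- by apply: gap_family_right g; rewrite // ln andbT ltnW.
Qed.

(** The three kinds of cells of the next generation are the families started by
    the end of J_s itself and by the two sides of its first gap. *)
Lemma cell_gap_family j s m i u v : (0 < m)%N -> (size s).+1 = kk m ->
  cell i m u v -> gap_family a kk j s m (m + i) (anchored j s u v).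
Proof.
elim: i j s m u v => [|i IH] j s m u v m0 ss.
  move=> /= [-> ->]; rewrite addn0 -gapE //; exact: gap_family_start.
have IH' j' t x y : (size t < kk m.+1)%N ->
  (forall n', (m < n')%N -> gap_family a kk j s m n' (gapbar a kk j' t n')) ->
  cell i m.+1 x y -> gap_family a kk j s m (m + i.+1) (anchored j' t x y).
  move=> st seed c; apply: (gap_family_sub st seed).
  have := IH j' (padto kk j' t m.+1) m.+1 x y isT (size_padto j' st) c.
  rewrite addSnnS /anchored /padto.
  by case: (ord2P j') => ->; rewrite /= ?Jends_pad_left ?Jends_pad_right.
have lt_kk := kk_lt m; have m1 : (kk m - 1)%N = size s by lia.
have dg b : (size (rcons s b) < kk m.+1)%N by rewrite size_rcons ss.
have left_seed n' : (m < n')%N -> gap_family a kk j s m n'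
    (gapbar a kk ord_max (rcons s (dig j)) n').
  case: n' => // n' mn; apply: (@gap_family_left _ _ _ _ _ _ _ m j) => //.
    by rewrite leqnn.
  exact: gap_family_start.
have right_seed n' : (m < n')%N -> gap_family a kk j s m n'
    (gapbar a kk ord0 (rcons s (digS j)) n').
  case: n' => // n' mn; apply: (@gap_family_right _ _ _ _ _ _ _ m j) => //.
    by rewrite leqnn.
  exact: gap_family_start.
have main_seed n' : (m < n')%N -> gap_family a kk j s m n' (gapbar a kk j s n').
  by case: n' => // n' mn; exact: gap_family_main.
have len := Jends_len s; have ss' : (size s < kk m.+1)%N by lia.
case=> [/(IH' _ _ _ _ ss' main_seed) //|c|c].
  have gl := IH' _ _ _ _ (dg _) left_seed c.
  have gr := IH' _ _ _ _ (dg _) right_seed c.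
  case: (ord2P j) gl gr => -> gl gr; [move: gl|move: gr]; congr gap_family;
    rewrite /anchored !Jends_rcons /Jchild /Defs.center /= ss;
    by apply: itv_oo_congr; ring.
have gl := IH' _ _ _ _ (dg _) left_seed c.
have gr := IH' _ _ _ _ (dg _) right_seed c.
rewrite /jump -ss /= in gl gr.
case: (ord2P j) gl gr => -> gl gr; [move: gr|move: gl]; congr gap_family;
  rewrite /anchored !Jends_rcons /Jchild /Defs.center /= len;
  by apply: itv_oo_congr; field.
Qed.

Lemma gaps_ofE m : (0 < m)%N -> (0 < kk m)%N ->
  \bigcup_(U in gaps_of a kk [::] m) U =
  [set x | edge_gaps a kk m (x + 1) \/ edge_gaps a kk m (1 - x)].
Proof.
move=> m0 km; have sz j : (size (padto kk j [::] m)).+1 = kk m by exact: size_padto.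
have e0 : (Jends a (padto kk ord0 [::] m)).1 = -1 by rewrite Jends_pad_left.
have e1 : (Jends a (padto kk ord_max [::] m)).2 = 1 by rewrite Jends_pad_right.
apply/seteqP; split=> x /=.
  case=> U [] [n mn] /(gap_family_cell m0 (sz _))[_ [u [v [c ->]]]];
    rewrite /anchored /= ?e0 ?e1 in_itv /= => /andP[h1 h2]; [left|right];
    exists (n - m)%N => //; exists u, v; split=> //; apply/andP; split; lra.
case=> -[i _ [u [v [c /andP[h1 h2]]]]].
- exists (anchored ord0 (padto kk ord0 [::] m) u v).
    by left; exists (m + i)%N; [exact: leq_addr|exact: cell_gap_family].
  by rewrite /anchored /= e0 in_itv /=; apply/andP; split; lra.
- exists (anchored ord_max (padto kk ord_max [::] m) u v).
    by right; exists (m + i)%N; [exact: leq_addr|exact: cell_gap_family].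
  by rewrite /anchored /= e1 in_itv /=; apply/andP; split; lra.
Qed.

(** The three copies of the later gaps lie below dlen a (kk m), between it and its
    double, and beyond the first gap. *)
Lemma level_inj i j m (x : R) : (0 < m)%N ->
  level a kk i m x -> level a kk j m x -> i = j.
Proof.
move=> m0.
elim: i j m x m0 => [|i IH] [|j] m x m0 //;
  have itv l (y : R) := @level_itv _ _ _ a01 kk_lt kk_gap l m.+1 y isT;
  have s1 := jumps_le a01 kk_lt (ltn0Sn m) (kk_lt m);
  have d0 := dlen_gt0 a01 (kk m);
  have j0 : 2 * d (kk m) < jump m by (have := kk_gap m0; rewrite /jump; lra).
- rewrite level0 levelS /= => /andP[h1 h2] [] /itv/andP[h3 h4]; exfalso; lra.
- rewrite level0 levelS /= => -[] /itv/andP[h3 h4] /andP[h1 h2]; exfalso; lra.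
rewrite !levelS /=; case=> /[dup] h /itv/andP[h1 h2]; case=> /[dup] h' /itv/andP[h3 h4];
  first [by rewrite (IH _ _ _ (ltn0Sn m) h h') | exfalso; lra].
Qed.

(** The recursion reflects and translates the gaps of the previous generation, so
    the induction has to treat all their preimages under x |-> s * x + c at once. *)
Lemma level_measure j m (s c : R) : (0 < m)%N -> s = 1 \/ s = -1 ->
  let A := [set x : R | level a kk j m (s * x + c)] in
  measurable A /\ lebesgue_measure A =
    (3 ^+ j * (d (kk (m + j)).-1 - 3 * d (kk (m + j))))%:E.
Proof.
elim: j m s c => [|j IH] m s c m0 hs A.
  have j0 := kk_gap m0.
  have [u [v [-> uv]]] : exists u v : R,
      A = [set` `]u, v[] /\ v - u = jump m - 2 * d (kk m).
    case: hs => es.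
      exists (2 * d (kk m) - c), (jump m - c); split; last by ring.
      rewrite /A level0 es; apply/seteqP; split=> x /=; rewrite in_itv /= => /andP[h1 h2];
        by apply/andP; split; lra.
    exists (c - jump m), (c - 2 * d (kk m)); split; last by ring.
    rewrite /A level0 es; apply/seteqP; split=> x /=; rewrite in_itv /= => /andP[h1 h2];
      by apply/andP; split; lra.
  split; first exact: measurable_itv.
  rewrite lebesgue_measure_itv /= lte_fin ifT; last by move: uv; rewrite /jump; lra.
  by rewrite expr0 mul1r addn0 -EFinB uv /jump; congr EFin; ring.
set D := d (kk m).
have [m1 e1] := IH m.+1 s c isT hs.
have hs' : - s = 1 \/ - s = -1 by case: hs => ->; rewrite ?opprK; [right|left].
have [m2 e2] := IH m.+1 (- s) (2 * D - c) isT hs'.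
have [m3 e3] := IH m.+1 s (c - jump m) isT hs.
have -> : A = [set x | level a kk j m.+1 (s * x + c)] `|`
   [set x | level a kk j m.+1 (- s * x + (2 * D - c))] `|`
   [set x | level a kk j m.+1 (s * x + (c - jump m))].
  have r2 x : - s * x + (2 * D - c) = 2 * d (kk m) - (s * x + c) by rewrite /D; ring.
  have r3 x : s * x + (c - jump m) = s * x + c - jump m by ring.
  rewrite /A levelS; apply/seteqP; split=> x /=; rewrite r2 r3.
    by case; [left; left|left; right|right].
  by case=> [[]|]; [constructor 1|constructor 2|constructor 3].
have itv (y : R) := @level_itv _ _ _ a01 kk_lt kk_gap j m.+1 y isT.
have s1 := jumps_le a01 kk_lt (ltn0Sn m) (kk_lt m).
have d0 := dlen_gt0 a01 (kk m).
have j0 : 2 * d (kk m) < jump m by (have := kk_gap m0; rewrite /jump; lra).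
split; first by apply: measurableU => //; exact: measurableU.
rewrite measureU //; [|exact: measurableU|]; last first.
  apply/seteqP; split=> x //= -[[] /itv/andP[h1 h2] /itv/andP[h3 h4]];
    rewrite /D in h1 h2; lra.
rewrite measureU //; last first.
  by apply/seteqP; split=> x //= -[/itv/andP[h1 h2] /itv/andP[h3 h4]];
    rewrite /D in h3 h4; lra.
rewrite /= e1 e2 e3 -!EFinD addSnnS; congr EFin; rewrite exprS; ring.
Qed.

Lemma edge_gaps_measure (s c : R) : s = 1 \/ s = -1 ->
  let A := [set x : R | edge_gaps a kk 1 (s * x + c)] in
  measurable A /\ lebesgue_measure A =
    (\sum_(1 <= n <oo) (3 ^+ n.-1 * (d (kk n).-1 - 3 * d (kk n)))%:E)%E.
Proof.
move=> hs A; pose F j := [set x : R | level a kk j 1 (s * x + c)].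
have -> : A = \bigcup_j F j.
  by apply/seteqP; split=> x [j _ h]; exists j.
have mF j : measurable (F j) by case: (level_measure j c (ltn0Sn 0) hs).
split; first exact: bigcup_measurable.
rewrite measure_bigcup; [|by move=> i _; exact: mF|]; last first.
  move=> i j _ _ [x [hi hj]]; exact: level_inj hi hj.
transitivity (\sum_(0 <= j <oo) lebesgue_measure (F (j + 1).-1))%E.
  apply: congr_lim; apply/funext => n.
  by apply: congr_big => // j; rewrite ?in_setT ?addn1.
rewrite (@nneseries_addn _ (fun n => lebesgue_measure (F n.-1))); last first.
  by move=> i; exact: measure_ge0.
apply: congr_lim; apply/funext => n; apply: eq_big_nat => -[//|j] _.
by have [_ /=] := level_measure j c (ltn0Sn 0) hs; rewrite add1n.
Qed.

Lemma trim_measure : jumps a kk 1 <= 1 ->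
  lebesgue_measure (trim (edge_gaps a kk 1) 1) =
  (2%:E - 2%:E * \sum_(1 <= n <oo)
          (3 ^+ n.-1 * (d (kk n).-1 - 3 * d (kk n)))%:E)%E.
Proof.
move=> j1; have itv (x : R) := @edge_gaps_itv _ _ _ a01 kk_lt kk_gap 1 x isT.
have [mX eX] := edge_gaps_measure 1 (or_introl erefl).
have [mY eY] := edge_gaps_measure 1 (or_intror erefl).
set X := [set x | _] in mX eX; set Y := [set x | _] in mY eY.
set S := (\sum_(_ <= _ <oo) _)%E in eX eY *.
have XI : X `<=` [set` `[-1, 1]].
  by move=> x /itv/andP[h1 h2]; rewrite /= in_itv /=; apply/andP; split; lra.
have YI : Y `<=` [set` `[-1, 1]].
  by move=> x /itv/andP[h1 h2]; rewrite /= in_itv /=; apply/andP; split; lra.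
have mI : lebesgue_measure ([set` `[-1, 1]] : set R) = 2%:E.
  by rewrite lebesgue_measure_itv /= lte_fin ifT -?EFinB; [congr EFin; ring|lra].
have -> : trim (edge_gaps a kk 1) 1 = [set` `[-1, 1]] `\` (X `|` Y).
  apply/seteqP; split=> x; rewrite /trim /X /Y /= in_itv /= mul1r mulN1r [- x + 1]addrC.
    by case=> -> nX nY; split=> //; case.
  by case=> -> /not_orP[].
have mXY : measurable (X `|` Y) by exact: measurableU.
rewrite measureD //=; last by rewrite mI ltry.
rewrite mI setIidr; last by move=> x [/XI|/YI].
rewrite measureU //; last first.
  by apply/seteqP; split=> x //= -[/itv/andP[h1 h2] /itv/andP[h3 h4]]; lra.
rewrite /= eX eY -mule2n.
by rewrite -(mule_natl S 2).
Qed.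

End Families.

(** The extended-real bound amounts to inequalities between reals for each overlap
    between delta and Delta; s is the sum of the later jumps. *)
Lemma mbound_margin (R : realType) (a : nat -> R) (kk : nat -> nat) n i (s : R) :
  ((2 * s)%:E <= mbound a kk n)%E -> (kk n.-1 < i < kk n)%N ->
  jump a kk n + 2 * s <= 3 * dlen a i - dlen a i.-1 /\
  3 * dlen a i - dlen a i.-1 <= 4 * dlen a (kk n) - 2 * s.
Proof.
rewrite /mbound le_min => /andP[h1 h2] hi; pose o := 3 * dlen a i - dlen a i.-1.
have ir : i \in index_iota (kk n.-1).+1 (kk n) by rewrite mem_index_iota.
have lo : (delta a kk n <= o%:E)%E by exact: ge_bigmin_seq.
have hi' : (o%:E <= Delta a kk n)%E by exact: le_bigmax_seq.
split.
  move: h1; rewrite leeBrDr // -EFinD => /le_trans/(_ lo); rewrite lee_fin /jump.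
  by rewrite addrC.
have : ((2 * s)%:E <= (4 * dlen a (kk n))%:E - o%:E)%E.
  by apply: le_trans h2 _; apply: leeB.
by rewrite -EFinB lee_fin /o; lra.
Qed.

Theorem theorem3p1 (R : realType) (a : nat -> R)
    (a01 : forall n, (0 < n)%N -> 0 < a n < 1)
    (a_inf : infinite_set [set n | (0 < n)%N /\ 1 / 3 < a n])
    (k0 : nat) (ak0 : a k0.+1 < 1 / 3)
    (kk : nat -> nat) (kk0 : kk 0%N = k0)
    (kk_incr : forall n, (0 < n)%N -> (kk n < kk n.+1)%N)
    (kk_range : forall j, (k0 < j)%N /\ 1 / 3 < a j <->
                          exists n, (0 < n)%N /\ kk n = j)
    (k : nat) (hk0 : (k0 <= k)%N) (t : k.-tuple 'I_3)
    (m : nat) (m_gt0 : (0 < m)%N) (hm : (kk m.-1 <= k < kk m)%N)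
    (hbound : forall n, (0 < n)%N ->
      (2%:E * \sum_(n.+1 <= i <oo) (dlen a (kk i).-1 - dlen a (kk i))%:E
         <= mbound a kk n)%E) :
  cantorval (diff_set (central_cantor a) (central_cantor a)) /\
  (k = 0%N -> k0 = 0%N -> tval t = [::] ->
     diff_set (central_cantor a) (central_cantor a) =
       Jset a t `\` \bigcup_(U in gaps_of a kk t m) U /\
     lebesgue_measure (diff_set (central_cantor a) (central_cantor a)) =
       (2%:E - 2%:E * \sum_(1 <= n <oo)
          (3 ^+ n.-1 * (dlen a (kk n).-1 - 3 * dlen a (kk n)))%:E)%E).
Proof.
have kk_lt n : (kk n < kk n.+1)%N.
  case: n => [|n]; last exact: kk_incr.
  by rewrite kk0; have [_ /(_ (ex_intro _ 1%N (conj isT erefl)))[]] := kk_range (kk 1).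
have a_kk n : (0 < n)%N -> 1 / 3 < a (kk n).
  by move=> n0; have [_ /(_ (ex_intro _ n (conj n0 erefl)))[]] := kk_range (kk n).
have kk_gap n : (0 < n)%N -> 3 * dlen a (kk n) < dlen a (kk n).-1.
  move=> n0; have := a_kk n n0; have := kk_lt n.-1; rewrite prednK //.
  by case: (kk n) => // j _; rewrite gap_cond.
have kk_first : ((kk 0).+1 < kk 1)%N.
  rewrite ltn_neqAle kk_lt andbT; apply/eqP => e.
  by have := a_kk 1%N isT; rewrite -e kk0; lra.
have kk_margin n i : (0 < n)%N -> (kk n.-1 < i < kk n)%N ->
    jump a kk n + 2 * jumps a kk n.+1 <= 3 * dlen a i - dlen a i.-1 /\
    3 * dlen a i - dlen a i.-1 <= 4 * dlen a (kk n) - 2 * jumps a kk n.+1.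
  move=> n0; apply: mbound_margin; rewrite EFinM.
  by rewrite -(jumpsE a01 kk_lt (ltn0Sn n)).1; exact: hbound.
have -> : diff_set (central_cantor a) (central_cantor a) = diff_tail a 0.
  by rewrite central_cantorE.
split.
  apply: diff_tail_cantorval => // N; last exact: diff_tail_has_itv.
  exists (kk N.+1).-1; first by have := kk_ge kk_lt N.+1; lia.
  by have := kk_gap N.+1 isT; have := kk_ge kk_lt N.+1; case: (kk N.+1).
move=> k_eq0 k0_eq0 t_nil; have kk00 : kk 0 = 0%N by rewrite kk0.
have kk1 : (0 < kk 1)%N by exact: leq_ltn_trans (kk_lt 0%N).
have m1 : m = 1%N.
  by apply: (@kk_phase_inj kk kk_lt 0) => //=; rewrite ?kk00 ?kk1 // -k_eq0.
have -> : diff_tail a 0 = trim (edge_gaps a kk 1) 1.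
  rewrite (diff_tail_trimmed a01 kk_lt kk_gap kk_margin) ?kk00 //.
  rewrite (@trimmedE _ _ _ kk_lt 0 1) //= ?kk00 //.
  by rewrite dlen0.
split.
  rewrite t_nil m1 gaps_ofE // /Jset /Jends /itv_set /=.
  apply/seteqP; split=> x; rewrite /trim /= in_itv /=.
    by case=> -> nX nY; split=> //; case.
  by case=> -> /not_orP[].
apply: trim_measure => //; rewrite -(dlen0 a); exact: jumps_le.
Qed.
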